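(* Let $d\ge2$, $0\le k\le d$ and $r\ge1$, and let $T\subset\mathbb R^d$ be a $d$-simplex. For every $e\in\Delta_s(T)$, $0\le s\le d$, let $\{\boldsymbol t_1^e,\dots,\boldsymbol t_s^e\}$ be an orthonormal basis of $\mathscr T^e$. Then there is the direct sum decomposition $$\mathbb P_r\Lambda^k(T)=\bigoplus_{s=0}^d\ \bigoplus_{e\in\Delta_s(T)}\ \bigoplus_{\ell=\max\{s,k\}}^{\min\{k+s,d\}}\ \bigoplus_{f\in\Delta_\ell(T),\,f\supseteq e}\ \bigoplus_{\sigma\in\Sigma(s+k-\ell,s)}\left(b_e\,\mathbb P_{r-(s+1)}(e)\,\mathrm dt_\sigma^e\wedge\mathrm d\lambda_{[f\setminus e]}\right).$$ Moreover, an element $\omega\in\mathbb P_r\Lambda^k(T)$ is uniquely determined by the degrees of freedom $$\int_e\big\langle\omega,\ \mathrm dt_\sigma^e\wedge\mathrm d_f\widehat\lambda_{[f\setminus e]}\big\rangle\,q\,\mathrm ds,$$ where $e\in\Delta_s(T)$ with $0\le s\le d$, $f\in\Delta_\ell(T)$ with $f\supseteq e$ and $\max\{s,k\}\le\ell\le\min\{k+s,d\}$, $q\in\mathbb P_{r-(s+1)}(e)$, and $\sigma\in\Sigma(s+k-\ell,s)$.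
   Context: $T$ has vertices $\mathtt v_0,\dots,\mathtt v_d$ and barycentric coordinates $\lambda_0,\dots,\lambda_d$. $\Delta_s(T)$ is the set of $s$-dimensional subsimplices of $T$; each is identified with its set of vertex indices in $\{0,\dots,d\}$. $\mathscr T^e\subseteq\mathbb R^d$ is the tangent space of $e$ (span of differences of vertices), $\mathscr T^T=\mathbb R^d$. $\operatorname{Alt}^k(V)$ is the space of alternating $k$-linear forms on $V$, with its usual induced inner product $\langle\cdot,\cdot\rangle$ on $\operatorname{Alt}^k(\mathbb R^d)$ (for which $\{\mathrm dx_{\sigma(1)}\wedge\dots\wedge\mathrm dx_{\sigma(k)}\}$ is orthonormal). $\mathbb P_r\Lambda^k(T)=\mathbb P_r(T)\otimes\operatorname{Alt}^k(\mathscr T^T)$ is the space of $k$-forms on $T$ with polynomial coefficients of degree $\le r$. $\Sigma(m,n)$ is the set of increasing maps $\{1,\dots,m\}\to\{1,\dots,n\}$ (a single, empty map if $m=0$). For $\boldsymbol u\in\mathbb R^d$, $\mathrm du:=\boldsymbol u^\flat$ is the 1-form $\boldsymbol v\mapsto\boldsymbol u\cdot\boldsymbol v$, and $\mathrm dt^e_\sigma:=\mathrm dt^e_{\sigma(1)}\wedge\cdots\wedge\mathrm dt^e_{\sigma(m)}$. For a subsimplex $g$, $\nabla_g\lambda_i$ is the orthogonal projection of $\nabla\lambda_i$ onto $\mathscr T^g$ and $\mathrm d_g\lambda_i:=(\nabla_g\lambda_i)^\flat$. For $e\subseteq f$, with wedge factors in increasing order of $j\in f\setminus e$, $\mathrm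 d\lambda_{[f\setminus e]}:=\bigwedge_{j\in f\setminus e}\mathrm d\lambda_j$ and $\mathrm d_f\widehat\lambda_{[f\setminus e]}:=\bigwedge_{j\in f\setminus e}\mathrm d_{e\cup\{j\}}\lambda_j$; empty wedge products equal $1$. $b_e:=\prod_{i\in e}\lambda_i$. For $m\geq 0$, $\mathbb P_m(e)$ is the space of polynomials of degree $\le m$ on $e$ (equal to $\mathbb R$ if $e$ is a vertex), and it is viewed inside $\mathbb P_m(T)$ through the Bernstein extension, i.e. as the span of the monomials $\prod_{i\in e}\lambda_i^{\alpha_i}$ with $\sum_{i\in e}\alpha_i=m$; $\mathbb P_m(e)=\{0\}$ for $m<0$. For a vertex $\mathtt v$, $\int_{\mathtt v}u\,\mathrm ds=u(\mathtt v)$. ''Uniquely determined by the degrees of freedom'' means that two elements of the space with the same values of all these functionals are equal. *)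

(* Defs.v *)
From HB Require Import structures.
From mathcomp Require Import all_boot all_order all_algebra all_fingroup.
From mathcomp Require Import all_classical all_reals all_analysis.
From mathcomp Require mpoly.

Set Implicit Arguments.
Unset Strict Implicit.
Unset Printing Implicit Defensive.

Import Order.TTheory GRing.Theory Num.Theory.
Import numFieldNormedType.Exports.
(* Without its notations, which clash with those of mathcomp-analysis.        *)
Import -(notations) mpoly.

Local Open Scope classical_set_scope.
Local Open Scope ring_scope.

(* The nested direct sums of the decomposition are flattened into a single    *)
(* direct sum over a finite index type [I] restricted to [P].                 *)
Definition direct_sum (M : zmodType) (I : finType) (P : pred I)
    (W : I -> set M) (U : set M) : Prop :=
  U = [set u | exists2 w : I -> M,
         forall i, P i -> W i (w i) & u = \sum_(i | P i) w i]
  /\ forall w w' : I -> M,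
       (forall i, P i -> W i (w i)) -> (forall i, P i -> W i (w' i)) ->
       \sum_(i | P i) w i = \sum_(i | P i) w' i ->
       forall i, P i -> w i = w' i.

(* Increasing maps, 0-based: Sigma m n stands for the increasing maps         *)
(* {1, ..., m} -> {1, ..., n}.                                                *)
Definition Sigma (m n : nat) : {set {ffun 'I_m -> 'I_n}} :=
  [set sg : {ffun 'I_m -> 'I_n} |
    [forall i : 'I_m, forall j : 'I_m, (i < j)%N ==> (sg i < sg j)%N]].

Section EuclideanSpace.
Variables (R : realType) (d : nat).
Implicit Types (u v w x : 'rV[R]_d) (U : {vspace 'rV[R]_d}).

Definition dot u v : R := (u *m v^T) 0 0.

Definition orthonormal_basis U (s : nat) (t : s.-tuple 'rV[R]_d) : Prop :=
  basis_of U t /\ forall i j, dot (tnth t i) (tnth t j) = (i == j)%:R.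

(* The orthogonal projection of u onto U is the only w in U with u - w        *)
(* orthogonal to U.                                                           *)
Definition orthoproj U u : 'rV[R]_d :=
  xget 0 [set w | w \in U /\ forall z, z \in U -> dot (u - w) z = 0].

Definition gradient (g : 'rV[R]_d -> R) x : 'rV[R]_d :=
  \row_j 'D_(delta_mx 0 j) g x.

(* A k-linear form is a function of the k x d matrix whose rows are its k     *)
(* arguments; multilinearity is phrased as in determinant_multilinear.        *)
Definition Alt (k : nat) : set ('M[R]_(k, d) -> R) :=
  [set a | (forall (A B C : 'M[R]_(k, d)) i b c,
              row i A = b *: row i B + c *: row i C ->
              row' i B = row' i A -> row' i C = row' i A ->
              a A = b * a B + c * a C)
         /\ (forall (A : 'M[R]_(k, d)) i j,
              i != j -> row i A = row j A -> a A = 0)].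

Definition flat1 u : 'M[R]_(1, d) -> R := fun A => dot u (row 0 A).

(* Normalised so that u1 /\ ... /\ uk, for 1-forms ui, takes the value        *)
(* det (ui(vj)) at (v1, ..., vk).                                             *)
Definition altwedge (m n : nat) (a : 'M[R]_(m, d) -> R) (b : 'M[R]_(n, d) -> R) :
    'M[R]_(m + n, d) -> R :=
  fun A => (m`! * n`!)%N%:R^-1 *
    \sum_(p : 'S_(m + n))
      (-1) ^+ p * (a (usubmx (row_perm p A)) * b (dsubmx (row_perm p A))).

Fixpoint wedges (us : seq 'rV[R]_d) : 'M[R]_(size us, d) -> R :=
  match us return 'M[R]_(size us, d) -> R with
  | [::] => fun=> 1
  | u :: us' => @altwedge 1 (size us') (flat1 u) (@wedges us')
  end.

(* Transport of a form along m = k; only used when this equality holds.       *)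
Definition altcast (m k : nat) (a : 'M[R]_(m, d) -> R) : 'M[R]_(k, d) -> R :=
  fun A => a (conform_mx 0 A).

(* The inner product for which the forms dx_sg are orthonormal: the           *)
(* coefficient of dx_sg in a is a(e_sg(1), ..., e_sg(k)), and the rows of     *)
(* rowsub sg 1%:M are e_sg(1), ..., e_sg(k).                                  *)
Definition altdot (k : nat) (a b : 'M[R]_(k, d) -> R) : R :=
  \sum_(sg in Sigma k d) a (rowsub sg 1%:M) * b (rowsub sg 1%:M).

(* Polynomials on T are identified with polynomial functions on R^d, as T has *)
(* nonempty interior; msize is the total degree plus one.                     *)
Definition Poly (r : nat) : set ('rV[R]_d -> R) :=
  [set p | exists2 q : mpoly.mpoly d R,
     (mpoly.msize q <= r.+1)%N & p = fun x => mpoly.meval (x 0) q].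

Definition PolyForm (r k : nat) : set ('rV[R]_d -> 'M[R]_(k, d) -> R) :=
  [set om | exists (n : nat) (p : 'I_n -> 'rV[R]_d -> R)
                   (a : 'I_n -> 'M[R]_(k, d) -> R),
     [/\ forall j, @Poly r (p j), forall j, @Alt k (a j) &
         om = fun x A => \sum_j p j x * a j A]].

End EuclideanSpace.

Arguments wedges {R d} us _.
Arguments Poly {R d} r.
Arguments Alt {R d} k.
Arguments PolyForm {R d} r k.
Arguments altcast {R d m} k a _.

(* Integral of g over {y in R^s | y_j >= 0, y_1 + ... + y_s <= a} with        *)
(* respect to Lebesgue measure, as an iterated integral.                      *)
Fixpoint corner_integral (R : realType) (s : nat) (a : R) :
    ('rV[R]_s -> R) -> R :=
  match s return ('rV[R]_s -> R) -> R with
  | 0 => fun g => g 0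
  | s'.+1 => fun g =>
      \int[@lebesgue_measure R]_(y in `[0, a])
        @corner_integral R s' (a - y)
          (fun z : 'rV[R]_s' => g (row_mx (y%:M : 'rV[R]_1) z))
  end.

Definition subsimplices (d s : nat) : {set {set 'I_d.+1}} :=
  [set e : {set 'I_d.+1} | #|e| == s.+1].

Section Simplex.
Variables (R : realType) (d : nat) (V : 'I_d.+1 -> 'rV[R]_d).
Implicit Types (e f : {set 'I_d.+1}).

(* V lists the vertices of a (nondegenerate) d-simplex.                       *)
Definition affinely_independent : Prop :=
  row_free (\matrix_(i < d) (V (lift ord0 i) - V ord0)).

(* The row (bary i x)_i solves sum_i bary i x = 1, sum_i bary i x *: V i = x. *)
Definition bary (i : 'I_d.+1) (x : 'rV[R]_d) : R :=
  ((row_mx (1%:M : 'rV[R]_1) x : 'rV[R]_(1 + d)) *m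
    invmx (\matrix_(j < 1 + d) row_mx (1%:M : 'rV[R]_1) (V j) : 'M[R]_(1 + d)))
  0 i.

(* bary i is affine, so that its gradient is the same at every point.         *)
Definition grad_bary (i : 'I_d.+1) : 'rV[R]_d := gradient (bary i) 0.

Definition tangent e : {vspace 'rV[R]_d} :=
  <<[seq V i - V j | i <- enum e, j <- enum e]>>%VS.

Definition bubble e (x : 'rV[R]_d) : R := \prod_(i in e) bary i x.

Definition monomial e (al : 'I_d.+1 -> nat) (x : 'rV[R]_d) : R :=
  \prod_(i in e) bary i x ^+ al i.

(* P_m(e) inside P_m(T), by Bernstein extension.                              *)
Definition PolySub (m : int) e : set ('rV[R]_d -> R) :=
  match m with
  | Posz m' =>
      [set p | exists (n : nat) (c : 'I_n -> R) (al : 'I_n -> 'I_d.+1 -> nat),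
         (forall j, (\sum_(i in e) al j i)%N = m')
         /\ p = fun x => \sum_j c j * monomial e (al j) x]
  | Negz _ => [set fun=> 0]
  end.

(* Integral over e, for e of dimension s, with respect to s-dimensional       *)
(* measure, through the parametrisation of e by the unit corner of R^s that   *)
(* is given by the edges issued from its first vertex.                        *)
Definition edges (s : nat) e : 'M[R]_(s, d) :=
  \matrix_(j < s) (V (nth ord0 (enum e) j.+1) - V (nth ord0 (enum e) 0)).

Definition subsimplex_integral (s : nat) e (g : 'rV[R]_d -> R) : R :=
  Num.sqrt (\det (edges s e *m (edges s e)^T)) *
  corner_integral 1
    (fun y : 'rV[R]_s => g (V (nth ord0 (enum e) 0) + y *m edges s e)).

End Simplex.

(* Tuples (s, l, e, f, sg); the subtraction s + k - l is not truncated for    *)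
(* admissible ones.                                                           *)
Definition dofidx (d k : nat) : finType :=
  {p : 'I_d.+1 * 'I_d.+1 &
    ({set 'I_d.+1} * {set 'I_d.+1} * {ffun 'I_(p.1 + k - p.2) -> 'I_p.1})%type}.

Section Indices.
Variables (d k : nat) (i : dofidx d k).
Definition idx_s : 'I_d.+1 := (tag i).1.
Definition idx_l : 'I_d.+1 := (tag i).2.
Definition idx_e : {set 'I_d.+1} := (tagged i).1.1.
Definition idx_f : {set 'I_d.+1} := (tagged i).1.2.
Definition idx_sg : {ffun 'I_(idx_s + k - idx_l) -> 'I_idx_s} := (tagged i).2.

Definition admissible : bool :=
  [&& idx_e \in subsimplices d idx_s,
      (maxn idx_s k <= idx_l <= minn (k + idx_s) d)%N,
      idx_f \in subsimplices d idx_l, idx_e \subset idx_f &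
      idx_sg \in Sigma (idx_s + k - idx_l) idx_s].
End Indices.

Section Components.
Variables (R : realType) (d : nat) (V : 'I_d.+1 -> 'rV[R]_d).
Variable t : forall s : nat, {set 'I_d.+1} -> s.-tuple 'rV[R]_d.
Variables (k : nat) (i : dofidx d k).

Definition tangent_vectors : seq 'rV[R]_d :=
  [seq tnth (t (idx_s i) (idx_e i)) (idx_sg i j)
     | j <- enum 'I_(idx_s i + k - idx_l i)].

(* enum lists the vertices of f \ e in increasing order.                      *)
Definition shape_form : 'M[R]_(k, d) -> R :=
  altcast k (altwedge (wedges tangent_vectors)
    (wedges [seq grad_bary V j | j <- enum (idx_f i :\: idx_e i)])).

Definition dof_form : 'M[R]_(k, d) -> R :=
  altcast k (altwedge (wedges tangent_vectors)
    (wedges [seq orthoproj (tangent V (j |: idx_e i)) (grad_bary V j)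
               | j <- enum (idx_f i :\: idx_e i)])).

Definition coef_space (r : nat) : set ('rV[R]_d -> R) :=
  PolySub V (r%:Z - (idx_s i).+1%:Z) (idx_e i).

Definition component (r : nat) : set ('rV[R]_d -> 'M[R]_(k, d) -> R) :=
  [set om | exists2 p, coef_space r p &
     om = fun x A => bubble V (idx_e i) x * p x * shape_form A].

Definition dof (q : 'rV[R]_d -> R) (om : 'rV[R]_d -> 'M[R]_(k, d) -> R) : R :=
  subsimplex_integral V (idx_s i) (idx_e i)
    (fun x => altdot (om x) dof_form * q x).

End Components.

(* Main.v *)
Require Import Defs.
From HB Require Import structures.
From mathcomp Require Import all_boot all_order all_algebra all_fingroup.
From mathcomp Require Import all_classical all_reals all_analysis.
From mathcomp Require Import zify ring lra.
From mathcomp Require mpoly.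

(* Fix a face e of dimension s.  The vectors t_1, ..., t_s and grad lambda_j, *)
(* j not in e, form a basis of R^d, because they pair diagonally, with        *)
(* nonzero diagonal, with t_1, ..., t_s and the projections of grad lambda_j  *)
(* onto the tangent space of e + j.  By the Cauchy-Binet formula the k-fold   *)
(* wedges of this basis span Alt^k, and their Gram matrix with the forms of   *)
(* the degrees of freedom is diagonal with nonzero diagonal.  The monomials   *)
(* lambda^alpha of degree r span P_r; grouping them by support gives the      *)
(* decomposition.  If all degrees of freedom of a sum of components vanish,   *)
(* the components vanish by induction on s: on e only those attached to e     *)
(* survive, and testing against q = C p leaves int_e b_e (C p)^2 = 0.  This   *)
(* gives both the directness of the sum and unisolvence.                      *)

Set Implicit Arguments.
Unset Strict Implicit.
Unset Printing Implicit Defensive.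

Import Order.TTheory GRing.Theory Num.Theory.
Import numFieldNormedType.Exports.
Import -(notations) mpoly.
Local Open Scope classical_set_scope.
Local Open Scope ring_scope.

(** * Alternating forms and wedge products *)

(** The algebra rests on one formula, [Alt_Cauchy_Binet]. A wedge of 1-forms is a function [A] ->
    det(A U^T) ([altwedge_det], [wedgesE]), and the inner product of two such forms is det(U W^T)
    ([altdot_det]). Hence the pairing of shape forms with dual forms on a fixed face reduces to
    determinants of Gram matrices of vectors ([altdot_shape_dof]), and the spanning of Alt^k by the
    shape forms of that face to the invertibility of one d x d matrix ([Alt_shape_span]).

    Spanning of the decomposition is [PolyForm_component_sums]: a Bernstein monomial of degree r
    with support e is b_e times a monomial on e, and its alternating factor is expanded in the shape
    forms of that same e.

    Directness and unisolvence both follow from [components_eq0]: a sum of components on which all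
    degrees of freedom vanish has only zero terms. Its analytic input is [bubble_square_eq0]. Since
    the components are known to span, unisolvence needs no dimension count: the difference of two
    forms is itself a sum of components.

    Integrals are computed exactly on monomials ([corner_integral_monomials]), so that measure
    theory enters only through one-dimensional integrals of polynomials. *)

Section AlternatingForms.
Variables (R : realType) (d : nat).

Definition multilinear (k : nat) (a : 'M[R]_(k, d) -> R) : Prop :=
  forall (A B C : 'M[R]_(k, d)) i b c,
    row i A = b *: row i B + c *: row i C ->
    row' i B = row' i A -> row' i C = row' i A ->
    a A = b * a B + c * a C.

Definition setrow (k : nat) (A : 'M[R]_(k, d)) (i : 'I_k) (u : 'rV[R]_d) :
    'M[R]_(k, d) := \matrix_(x, y) if x == i then u 0 y else A x y.

Lemma row_setrow k (A : 'M[R]_(k, d)) i u : row i (setrow A i u) = u.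
Proof. by apply/rowP => j; rewrite !mxE eqxx. Qed.

Lemma row'_setrow k (A : 'M[R]_(k, d)) i u : row' i (setrow A i u) = row' i A.
Proof.
by apply/matrixP => x y; rewrite !mxE eq_sym (negPf (neq_lift i x)).
Qed.

Lemma setrow_row k (A : 'M[R]_(k, d)) i : setrow A i (row i A) = A.
Proof. by apply/matrixP => x y; rewrite !mxE; case: eqP => // ->. Qed.

Lemma multilinear_setrow k (a : 'M[R]_(k, d) -> R) A i b u c v :
  multilinear a ->
  a (setrow A i (b *: u + c *: v)) =
  b * a (setrow A i u) + c * a (setrow A i v).
Proof. by move=> am; apply: (am _ _ _ i); rewrite ?row_setrow ?row'_setrow. Qed.

Lemma multilinear_setrow_sum k (a : 'M[R]_(k, d) -> R) A i (I : Type)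
    (r : seq I) (b : I -> R) (u : I -> 'rV[R]_d) :
  multilinear a ->
  a (setrow A i (\sum_(j <- r) b j *: u j)) =
  \sum_(j <- r) b j * a (setrow A i (u j)).
Proof.
move=> am; elim: r => [|j r IH].
  have := multilinear_setrow A i 0 0 0 0 am.
  by rewrite !big_nil !scale0r addr0 !mul0r addr0.
rewrite !big_cons -IH -[X in b j *: u j + X]scale1r.
by rewrite multilinear_setrow // mul1r.
Qed.

(** Splits off the value at [ord0], so that sums over all maps can be handled by induction on the
    size of the source. *)
Definition ffun_cons (k m : nat) (p : 'I_m * {ffun 'I_k -> 'I_m}) :
    {ffun 'I_k.+1 -> 'I_m} :=
  [ffun i => if unlift ord0 i is Some i' then p.2 i' else p.1].

Lemma ffun_cons0 k m (p : 'I_m * {ffun 'I_k -> 'I_m}) :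
  ffun_cons p ord0 = p.1.
Proof. by rewrite ffunE unlift_none. Qed.

Lemma ffun_consS k m (p : 'I_m * {ffun 'I_k -> 'I_m}) i :
  ffun_cons p (lift ord0 i) = p.2 i.
Proof. by rewrite ffunE liftK. Qed.

Lemma ffun_cons_bij k m : bijective (@ffun_cons k m).
Proof.
exists (fun f : {ffun 'I_k.+1 -> 'I_m} => (f ord0, [ffun i => f (lift ord0 i)])) => [[j f]|f] /=.
  by rewrite ffun_cons0; congr (_, _); apply/ffunP => i; rewrite ffunE ffun_consS.
apply/ffunP => i; rewrite ffunE.
by case: unliftP => [j|] ->; rewrite ?ffunE.
Qed.

Lemma col_mx_lift0 k (u : 'rV[R]_d) (A : 'M[R]_(k, d)) i y :
  (col_mx u A : 'M[R]_(k.+1, d)) (lift ord0 i) y = A i y.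
Proof. rewrite -rshift1; exact: col_mxEd. Qed.

Lemma col_mx_ord0 k (u : 'rV[R]_d) (A : 'M[R]_(k, d)) y :
  (col_mx u A : 'M[R]_(k.+1, d)) ord0 y = u 0 y.
Proof.
have -> : ord0 = lshift k (0 : 'I_1) by apply/val_inj.
exact: col_mxEu.
Qed.

Lemma row_col_mx_lift0 k (u : 'rV[R]_d) (A : 'M[R]_(k, d)) i :
  row (lift ord0 i) (col_mx u A : 'M[R]_(k.+1, d)) = row i A.
Proof. by apply/rowP => y; rewrite [LHS]mxE [RHS]mxE col_mx_lift0. Qed.

Lemma row'_col_mx_lift0 k (u : 'rV[R]_d) (A B : 'M[R]_(k, d)) i :
  row' i A = row' i B ->
  row' (lift ord0 i) (col_mx u A : 'M[R]_(k.+1, d)) =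
  row' (lift ord0 i) (col_mx u B : 'M[R]_(k.+1, d)).
Proof.
move=> /matrixP e; apply/matrixP => x y; rewrite [LHS]mxE [RHS]mxE.
case: (unliftP ord0 (lift (lift ord0 i) x)) => [z|] ez; rewrite ez.
  rewrite !col_mx_lift0.
  have : i != z.
    by apply: contra_eq_neq ez => <-; rewrite eq_sym neq_lift.
  by move=> /unlift_some [w -> _]; have := e w y; rewrite !mxE.
by rewrite !col_mx_ord0.
Qed.

(** Each row of [B *m N] is a combination of the rows of [N]. Linearity expands the first row; with
    that argument frozen, the form is multilinear in the others and induction applies. *)
Lemma multilinear_expand k m (a : 'M[R]_(k, d) -> R) (B : 'M[R]_(k, m))
    (N : 'M[R]_(m, d)) :
  multilinear a ->
  a (B *m N) =
  \sum_(f : {ffun 'I_k -> 'I_m}) (\prod_i B i (f i)) * a (rowsub f N).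
Proof.
elim: k a B => [|k IH] a B am.
  pose f0 : {ffun 'I_0 -> 'I_m} := [ffun i => widen_ord (leq0n m) i].
  rewrite (big_pred1 f0) => [|f]; last first.
    by apply/esym/eqP/ffunP => -[].
  by rewrite big_ord0 mul1r; congr a; apply/matrixP => -[].
rewrite (reindex _ (onW_bij _ (ffun_cons_bij k m))) /=.
rewrite -(pair_bigA _ (fun j f => (\prod_i B i (ffun_cons (j, f) i)) *
  a (rowsub (ffun_cons (j, f)) N))) /=.
rewrite -[B *m N](setrow_row _ ord0) row_mul mulmx_sum_row.
rewrite multilinear_setrow_sum //; apply: eq_bigr => j _.
pose a' (A : 'M[R]_(k, d)) := a (col_mx (row j N) A : 'M[R]_(1 + k, d)).
pose B' : 'M[R]_(k, m) := \matrix_(i, j) B (lift ord0 i) j.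
have am' : multilinear a'.
  move=> A1 A2 A3 i b c e1 e2 e3; apply: (am _ _ _ (lift ord0 i)).
  - by rewrite !row_col_mx_lift0.
  - exact: row'_col_mx_lift0.
  - exact: row'_col_mx_lift0.
have -> : setrow (B *m N) ord0 (row j N) = col_mx (row j N) (B' *m N) :> 'M[R]_(1 + k, d).
  apply/matrixP => x y; rewrite [LHS]mxE.
  case: (unliftP ord0 x) => [z|] ->.
    rewrite eq_sym (negPf (neq_lift _ _)) col_mx_lift0 !mxE.
    by apply: eq_bigr => i _; rewrite !mxE.
  by rewrite eqxx col_mx_ord0.
rewrite -[a _]/(a' _) IH // mxE big_distrr /=; apply: eq_bigr => f _.
rewrite mulrA; congr (_ * _).
  rewrite big_ord_recl ffun_cons0; congr (_ * _).
  by apply: eq_bigr => i _; rewrite ffun_consS mxE.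
congr a; apply/matrixP => x y; case: (unliftP ord0 x) => [z|] ->.
  by rewrite col_mx_lift0 ![in LHS]mxE [RHS]mxE ffun_consS.
by rewrite col_mx_ord0 [LHS]mxE [RHS]mxE ffun_cons0.
Qed.

Lemma Alt_multilinear k (a : 'M[R]_(k, d) -> R) : Alt k a -> multilinear a.
Proof. by case. Qed.

(** Polarisation: with u + v in both slots, the terms with a repeated argument vanish, and the two
    mixed terms must cancel. *)
Lemma Alt_xrow k (a : 'M[R]_(k, d) -> R) (A : 'M[R]_(k, d)) i j :
  Alt k a -> i != j -> a (xrow i j A) = - a A.
Proof.
move=> [am aa] ij.
pose S u v := setrow (setrow A i u) j v.
have SiC u v : S u v = setrow (setrow A j v) i u.
  apply/matrixP => x y; rewrite !mxE.
  by have [->|_] := eqVneq x j; rewrite // eq_sym (negPf ij).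
have diag u : a (S u u) = 0.
  by apply: (aa _ i j ij); rewrite {1}SiC !row_setrow.
pose u := row i A; pose v := row j A.
have := diag (1 *: u + 1 *: v).
rewrite /S multilinear_setrow // -!/(S _ _) !SiC !multilinear_setrow //.
rewrite -!SiC !diag !mul1r add0r addr0 => /eqP.
rewrite addr_eq0 => /eqP e.
suff [<- <-] : S v u = xrow i j A /\ S u v = A by [].
split; apply/matrixP => x y; rewrite !mxE.
  have [->|xj] := eqVneq x j; first by rewrite tpermR.
  have [->|xi] := eqVneq x i; first by rewrite tpermL.
  by rewrite tpermD // eq_sym.
have [->|xj] := eqVneq x j; first by [].
by have [->|xi] := eqVneq x i.
Qed.

Lemma Alt_row_perm k (a : 'M[R]_(k, d) -> R) (A : 'M[R]_(k, d)) (p : 'S_k) :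
  Alt k a -> a (row_perm p A) = (-1) ^+ p * a A.
Proof.
move=> aA; have [ts -> dts] := prod_tpermP p.
elim: ts dts A => [|t ts IH] /=.
  by move=> _ A; rewrite big_nil row_perm1 odd_perm1 mul1r.
case/andP => dt dts A; rewrite big_cons row_permM.
rewrite -[row_perm (tperm _ _) _]/(xrow _ _ _) Alt_xrow // IH //.
by rewrite odd_permM odd_tperm dt signr_addb mulN1r mulNr.
Qed.

Lemma Alt_noninjective k m (a : 'M[R]_(k, d) -> R) (f : {ffun 'I_k -> 'I_m})
    (N : 'M[R]_(m, d)) :
  Alt k a -> ~~ injectiveb f -> a (rowsub f N) = 0.
Proof.
move=> [_ aa] /injectivePn [i [j ij e]]; apply: (aa _ i j ij).
by apply/rowP => y; rewrite !mxE e.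
Qed.

End AlternatingForms.

(** * Increasing maps *)

Lemma SigmaP m n (sg : {ffun 'I_m -> 'I_n}) :
  reflect (forall i j : 'I_m, (i < j)%N -> (sg i < sg j)%N) (sg \in Sigma m n).
Proof.
rewrite inE; apply: (iffP forallP) => [h i j|h i].
  by have /forallP/(_ j)/implyP := h i.
by apply/forallP => j; apply/implyP/h.
Qed.

Lemma Sigma_inj m n (sg : {ffun 'I_m -> 'I_n}) :
  sg \in Sigma m n -> injective sg.
Proof.
move=> /SigmaP h i j e; apply/val_inj.
by case: (ltngtP i j) => // /h; rewrite e ltnn.
Qed.

Lemma sorted_enum_ord n (A : pred 'I_n) :
  sorted (fun i j : 'I_n => (i < j)%N) (enum A).
Proof.
rewrite /enum_mem; apply: sorted_filter; first by move=> x y z; apply: ltn_trans.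
have := iota_ltn_sorted 0 n; rewrite -val_enum_ord sorted_map.
by rewrite enumT.
Qed.

(** Two strictly sorted sequences with the same elements coincide; so an increasing map is
    determined by its image. *)
Lemma Sigma_enum m n (sg : {ffun 'I_m -> 'I_n}) : sg \in Sigma m n ->
  [seq sg i | i <- enum 'I_m] = enum (sg @: 'I_m).
Proof.
move=> h; apply: (@irr_sorted_eq _ (fun i j : 'I_n => (i < j)%N)).
- by move=> x y z; apply: ltn_trans.
- by move=> x; rewrite ltnn.
- rewrite sorted_map; apply: sub_sorted (sorted_enum_ord _) => i j.
  by move/SigmaP: h; apply.
- exact: sorted_enum_ord.
- move=> x; rewrite mem_enum; apply/mapP/imsetP => -[i ? ->]; exists i => //.
  by rewrite mem_enum.
Qed.

Lemma Sigma_imset_inj m n (sg tu : {ffun 'I_m -> 'I_n}) :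
  sg \in Sigma m n -> tu \in Sigma m n -> sg @: 'I_m = tu @: 'I_m -> sg = tu.
Proof.
move=> hs ht e; apply/ffunP => i; have := Sigma_enum hs.
rewrite e -(Sigma_enum ht) => /eq_in_map; apply; exact: mem_enum.
Qed.

(* Every injective map factors uniquely as an increasing map after a          *)
(* permutation of its source.                                                 *)
Lemma big_injective_Sigma (R : nmodType) m n (F : {ffun 'I_m -> 'I_n} -> R) :
  \sum_(f : {ffun 'I_m -> 'I_n} | injectiveb f) F f =
  \sum_(sg in Sigma m n) \sum_(p : 'S_m) F [ffun i => sg (p i)].
Proof.
pose A := [set q : {ffun 'I_m -> 'I_n} * 'S_m | q.1 \in Sigma m n]%SET.
pose h (q : {ffun 'I_m -> 'I_n} * 'S_m) : {ffun 'I_m -> 'I_n} :=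
  [ffun i => q.1 (q.2 i)].
have hi : {in A &, injective h}.
  move=> [s p] [t q]; rewrite finset.in_set /= => hs; rewrite finset.in_set /= => ht e.
  have est : s = t.
    apply: (Sigma_imset_inj hs ht); apply/setP => x.
    apply/imsetP/imsetP => -[i _ ->].
      exists (q (p^-1 i)%g) => //; have /ffunP/(_ (p^-1 i)%g) := e.
      by rewrite !ffunE /= permKV.
    exists (p (q^-1 i)%g) => //; have /ffunP/(_ (q^-1 i)%g) := e.
    by rewrite !ffunE /= permKV.
  rewrite est; congr (_, _); apply/permP => i; have /ffunP/(_ i) := e.
  by rewrite !ffunE est /=; apply: Sigma_inj.
transitivity (\sum_(f in h @: A) F f); last first.
  rewrite (big_imset _ hi) /= pair_big /=.
  by apply: eq_bigl => q; rewrite inE andbT.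
apply: eq_bigl => f; apply/injectiveP/imsetP => [fi|[[s p]]]; last first.
  rewrite finset.in_set => hs -> i j; rewrite !ffunE /=.
  by move/(Sigma_inj hs)/perm_inj.
have cS : #|f @: 'I_m| = m by rewrite card_imset // card_ord.
(* The increasing factor lists the image of [f]; the permutation [perm pi] sends i to the rank of
   [f i] in that list. *)
pose s : {ffun 'I_m -> 'I_n} := [ffun i => enum_val (cast_ord (esym cS) i)].
have hs : s \in Sigma m n.
  apply/SigmaP => i j ij; rewrite !ffunE.
  have x0 := s i.
  rewrite !(enum_val_nth x0).
  apply: (sorted_ltn_nth (leT := fun i j : 'I_n => (i < j)%N)) => //.
  - by move=> x y z; apply: ltn_trans.
  - exact: sorted_enum_ord.
  - by rewrite inE -cardE; apply: ltn_ord.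
  - by rewrite inE -cardE; apply: ltn_ord.
have fS i : f i \in f @: 'I_m by apply: imset_f.
have pi : injective (fun i => cast_ord cS (enum_rank_in (fS i) (f i))).
  move=> i j /cast_ord_inj e; apply: fi.
  by rewrite -(enum_rankK_in (fS i) (fS i)) e enum_rankK_in.
exists (s, perm pi); first by rewrite finset.in_set.
apply/ffunP => i; rewrite !ffunE /= permE cast_ordK enum_rankK_in //.
Qed.

Section CauchyBinet.
Variables (R : realType) (d : nat).

(** Non-injective maps drop out of the multilinear expansion. Grouping the injective ones by image
    leaves a signed sum over permutations for each image, which is a minor of [B]. *)
Lemma Alt_Cauchy_Binet k m (a : 'M[R]_(k, d) -> R) (B : 'M[R]_(k, m))
    (N : 'M[R]_(m, d)) :
  Alt k a ->
  a (B *m N) = \sum_(sg in Sigma k m) \det (colsub sg B) * a (rowsub sg N).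
Proof.
move=> aA; rewrite multilinear_expand; last exact: Alt_multilinear aA.
rewrite (bigID (fun f : {ffun 'I_k -> 'I_m} => injectiveb f)) /=.
rewrite [X in _ + X]big1 ?addr0 => [|f nf]; last first.
  by rewrite (Alt_noninjective _ aA nf) mulr0.
rewrite big_injective_Sigma; apply: eq_bigr => sg _.
rewrite big_distrl; apply: eq_bigr => p _ /=.
have -> : rowsub [ffun i => sg (p i)] N = row_perm p (rowsub sg N).
  by apply/matrixP => x y; rewrite !mxE ffunE.
rewrite (Alt_row_perm _ _ aA) mulrCA -mulrA; congr (_ * (_ * _)).
by apply: eq_bigr => i _; rewrite mxE ffunE.
Qed.

Lemma row'_mulmx m n p (i : 'I_m) (A : 'M[R]_(m, n)) (B : 'M[R]_(n, p)) :
  row' i (A *m B) = row' i A *m B.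
Proof.
by apply/matrixP => x y; rewrite !mxE; apply: eq_bigr => z _; rewrite !mxE.
Qed.

Lemma Alt_det k (U : 'M[R]_(k, d)) : Alt k (fun A => \det (A *m U^T)).
Proof.
split=> [A B C i b c e1 e2 e3|A i j ij e].
  apply: (@determinant_multilinear _ _ _ _ _ i).
  - by rewrite !row_mul e1 mulmxDl -!scalemxAl.
  - by rewrite !row'_mulmx e2.
  - by rewrite !row'_mulmx e3.
apply: (determinant_alternate ij) => x.
have /rowP/(_ x) : row i (A *m U^T) = row j (A *m U^T) by rewrite !row_mul e.
by rewrite !mxE.
Qed.

(** The values on coordinate vectors are the k-minors of [U] and [W], so this is Cauchy-Binet for
    the second form with [N] the identity. *)
Lemma altdot_det k (U W : 'M[R]_(k, d)) :
  altdot (fun A => \det (A *m U^T)) (fun A => \det (A *m W^T)) =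
  \det (U *m W^T).
Proof.
rewrite -[U in RHS]mulmx1.
rewrite (Alt_Cauchy_Binet U 1%:M (Alt_det W)); apply: eq_bigr => sg _.
congr (_ * _); rewrite -det_tr trmx_mul trmxK; congr (\det _).
apply/matrixP => i j; rewrite !mxE.
by rewrite (bigD1 (sg j)) //= big1 ?addr0 => [|x xj]; rewrite !mxE ?eqxx ?mulr1 //
  eq_sym (negPf xj) mulr0.
Qed.

End CauchyBinet.

(** * Wedge products as determinants *)

Section Wedges.
Variables (R : realType) (d : nat).

(* Expanding both determinants over permutations q and r, each pair (q, r)    *)
(* contributes one copy of the determinant on the right.                      *)
Lemma altwedge_det m n (U : 'M[R]_(m, d)) (W : 'M[R]_(n, d)) A :
  altwedge (fun A => \det (A *m U^T)) (fun A => \det (A *m W^T)) A =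
  \det (A *m (col_mx U W)^T).
Proof.
rewrite /altwedge; set C := A *m _.
(* The block permutation acting by [q] on the first m indices and by [r] on the last n; its sign is
   read off its block diagonal matrix. *)
pose b (q : 'S_m) (r : 'S_n) : 'I_(m + n) -> 'I_(m + n) := fun x =>
  match fintype.split x with inl i => lshift n (q i) | inr j => rshift m (r j) end.
have spl i : fintype.split (lshift n i) = inl i := unsplitK (inl i : 'I_m + 'I_n).
have spr i : fintype.split (rshift m i) = inr i := unsplitK (inr i : 'I_m + 'I_n).
have bi q r : injective (b q r).
  apply: (can_inj (g := b q^-1%g r^-1%g)) => x; rewrite /b.
  by case: (split_ordP x) => i ->; rewrite /= ?(spl, spr) ?permK.
pose B q r := perm (@bi q r).
have BE q r : perm_mx (B q r) = block_mx (perm_mx q) 0 0 (perm_mx r) :> 'M[R]_(m + n).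
  rewrite -[LHS]submxK; congr block_mx; apply/matrixP => i j; rewrite !mxE permE /b.
  - by rewrite spl (inj_eq (@lshift_inj _ _)).
  - by rewrite spl eq_lrshift.
  - by rewrite spr eq_rlshift.
  - by rewrite spr (inj_eq (@rshift_inj _ _)).
have Bsgn q r : (-1) ^+ (B q r) = (-1) ^+ q * (-1) ^+ r :> R.
  by rewrite -det_perm BE det_ublock !det_perm.
have step (p : 'S_(m + n)) : (-1) ^+ p *
   (\det (usubmx (row_perm p A) *m U^T) * \det (dsubmx (row_perm p A) *m W^T)) =
   \sum_q \sum_r (-1) ^+ p * ((-1) ^+ (B q r) * \prod_x C (p x) (B q r x)).
  rewrite big_distrl big_distrr /=; apply: eq_bigr => q _.
  rewrite big_distrr big_distrr /=; apply: eq_bigr => r _.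
  congr (_ * _); rewrite mulrACA Bsgn; congr (_ * _).
  rewrite big_split_ord /=; congr (_ * _); apply: eq_bigr => i _; rewrite permE /b.
    rewrite spl !mxE; apply: eq_bigr => j _.
    by rewrite !mxE spl.
  rewrite spr !mxE; apply: eq_bigr => j _.
  by rewrite !mxE spr.
rewrite (eq_bigr _ (fun p _ => step p)) exchange_big /=.
under eq_bigr do rewrite exchange_big /=.
have detB q r : \sum_(p : 'S_(m + n)) (-1) ^+ p * ((-1) ^+ (B q r) * \prod_x C (p x) (B q r x))
    = \det C.
  rewrite -det_tr (reindex_inj (mulgI (B q r))) /=; apply: eq_bigr => p _.
  rewrite odd_permM signr_addb mulrCA mulrA mulrA -signr_addb addbb mul1r.
  congr (_ * _); rewrite [RHS](reindex_inj (@perm_inj _ (B q r))) /=.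
  by apply: eq_bigr => x _; rewrite permM [RHS]mxE.
rewrite (eq_bigr (fun=> \sum_(r : 'S_n) \det C)) => [|q _]; last first.
  by apply: eq_bigr => r _; exact: detB.
(* The m! n! equal contributions cancel the normalisation of [altwedge]. *)
rewrite !sumr_const !card_Sn -mulrnA mulnC -[\det C *+ _]mulr_natl mulrA.
rewrite mulVf ?mul1r //.
Qed.

(** The number [k] of rows is kept apart from [size us], which avoids casts along equalities of
    sizes; rows past the end are zero. *)
Definition rowsmx (us : seq 'rV[R]_d) (k : nat) : 'M[R]_(k, d) :=
  \matrix_(i < k) nth 0 us i.

Definition detform (us : seq 'rV[R]_d) (k : nat) : 'M[R]_(k, d) -> R :=
  fun A => \det (A *m (rowsmx us k)^T).

Lemma rowsmx_cat us vs :
  rowsmx (us ++ vs) (size us + size vs) =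
  col_mx (rowsmx us (size us)) (rowsmx vs (size vs)).
Proof.
apply/matrixP => i y; rewrite [LHS]mxE.
case: (split_ordP i) => j ->; rewrite ?col_mxEu ?col_mxEd [RHS]mxE nth_cat /=.
  by rewrite ltn_ord.
by rewrite ltnNge leq_addr addKn.
Qed.

Lemma wedgesE us : wedges us = @detform us (size us).
Proof.
elim: us => [|u us IH] /=; first by apply/funext => A; rewrite /detform det_mx00.
have -> : flat1 u = fun A => \det (A *m (rowsmx [:: u] 1)^T).
  apply/funext => A; rewrite /flat1 /dot det_mx11 -[A in RHS](_ : row 0 A = _).
    by rewrite !mxE; apply: eq_bigr => j _; rewrite !mxE mulrC.
  by apply/rowP => j; rewrite !mxE.
apply/funext => A; rewrite IH /detform altwedge_det.
by rewrite -(rowsmx_cat [:: u] us).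
Qed.

Lemma altcast_altwedge_wedges k us vs : size us + size vs = k ->
  altcast k (altwedge (wedges us) (wedges vs)) = @detform (us ++ vs) k.
Proof.
move=> <-; apply/funext => A; rewrite /altcast conform_mx_id !wedgesE.
by rewrite altwedge_det -rowsmx_cat.
Qed.

End Wedges.

(** * Barycentric coordinates and their gradients *)

Section Dot.
Variables (R : realType) (d : nat).
Implicit Types u v w : 'rV[R]_d.

Lemma dotE u v : dot u v = \sum_j u 0 j * v 0 j.
Proof. by rewrite /dot mxE; apply: eq_bigr => j _; rewrite mxE. Qed.

Lemma dotC u v : dot u v = dot v u.
Proof. by rewrite !dotE; apply: eq_bigr => j _; rewrite mulrC. Qed.

Lemma dotDl u v w : dot (u + v) w = dot u w + dot v w.
Proof. by rewrite /dot mulmxDl mxE. Qed.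

Lemma dotZl (c : R) u w : dot (c *: u) w = c * dot u w.
Proof. by rewrite /dot -scalemxAl mxE. Qed.

Lemma dotDr u v w : dot w (u + v) = dot w u + dot w v.
Proof. by rewrite !(dotC w) dotDl. Qed.

Lemma dotZr (c : R) u w : dot w (c *: u) = c * dot w u.
Proof. by rewrite !(dotC w) dotZl. Qed.

Lemma dotBl u v w : dot (u - v) w = dot u w - dot v w.
Proof. by rewrite dotDl -scaleN1r dotZl mulN1r. Qed.

Lemma dot0l w : dot 0 w = 0.
Proof. by rewrite -(scale0r 0) dotZl mul0r. Qed.

Lemma dot0r w : dot w 0 = 0.
Proof. by rewrite dotC dot0l. Qed.

Lemma dot_sumr (I : Type) (r : seq I) (F : I -> 'rV[R]_d) w :
  dot w (\sum_(i <- r) F i) = \sum_(i <- r) dot w (F i).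
Proof.
elim: r => [|i r IH]; first by rewrite !big_nil dot0r.
by rewrite !big_cons dotDr IH.
Qed.

Lemma dot_suml (I : Type) (r : seq I) (F : I -> 'rV[R]_d) w :
  dot (\sum_(i <- r) F i) w = \sum_(i <- r) dot (F i) w.
Proof. by rewrite dotC dot_sumr; apply: eq_bigr => i _; rewrite dotC. Qed.

Lemma dot_eq0 u : (dot u u == 0) = (u == 0).
Proof.
apply/idP/idP => [|/eqP ->]; last by rewrite dot0l.
rewrite dotE psumr_eq0 => [/allP h|j _]; last by rewrite -expr2 sqr_ge0.
apply/eqP/rowP => j; rewrite mxE; apply/eqP.
by have := h j (mem_index_enum _); rewrite mulf_eq0 orbb.
Qed.

Lemma dot_span0 w (X : seq 'rV[R]_d) u :
  {in X, forall x, dot w x = 0} -> u \in <<X>>%VS -> dot w u = 0.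
Proof.
move=> h /(@coord_span _ _ _ (in_tuple X)) ->; rewrite dot_sumr big1 // => i _.
by rewrite dotZr h ?mulr0 // mem_nth.
Qed.

(** The expansion [w] of the projection in the orthonormal basis shows that the set inside
    [orthoproj] is inhabited, so that [xget] does not return its default. *)
Lemma orthoproj_basis (U : {vspace 'rV[R]_d}) s (t : s.-tuple 'rV[R]_d) u :
  orthonormal_basis U t ->
  orthoproj U u \in U /\
  forall z, z \in U -> dot (orthoproj U u) z = dot u z.
Proof.
move=> [/andP[/eqP bU _] to].
pose w := \sum_i dot u (tnth t i) *: tnth t i.
have := @xgetI _ 0 [set w | w \in U /\ forall z, z \in U -> dot (u - w) z = 0] w.
rewrite -/(orthoproj U u); case=> [|? h].
  split=> [|z]; rewrite -bU.
    apply: memv_suml => i _; apply/memvZ/memv_span; exact: mem_tnth.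
  apply: dot_span0 => _ /tnthP [j ->].
  rewrite dotBl dot_suml (bigD1 j) //= big1 => [|i ij]; rewrite dotZl to ?eqxx.
    by rewrite addr0 mulr1 subrr.
  by rewrite (negPf ij) mulr0.
by split=> // z /h; rewrite dotBl => /eqP; rewrite subr_eq0 => /eqP.
Qed.

End Dot.

Section Barycentric.
Variables (R : realType) (d : nat) (V : 'I_d.+1 -> 'rV[R]_d).

(** The matrix inverted in [bary]. *)
Definition vertex_mx : 'M[R]_(1 + d) :=
  \matrix_(j < 1 + d) row_mx (1%:M : 'rV[R]_1) (V j).

Hypothesis hV : affinely_independent V.


Lemma vertex_mx_sum (u : 'rV[R]_(1 + d)) :
  u *m vertex_mx = row_mx (\sum_i u 0 i)%:M (\sum_i u 0 i *: V i).
Proof.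
rewrite mulmx_sum_row; apply/rowP => j; rewrite summxE.
case: (split_ordP j) => {}j ->; rewrite ?row_mxEl ?row_mxEr.
  rewrite [RHS]mxE (ord1 j) eqxx mulr1n; apply: eq_bigr => i _.
  by rewrite rowK mxE row_mxEl mxE eqxx mulr1.
by rewrite summxE; apply: eq_bigr => i _; rewrite rowK mxE row_mxEr mxE.
Qed.

(** A row u in the kernel has coordinates of sum 0 with the combination of the vertices equal to 0.
    So the edges from vertex 0 are combined to 0 by the remaining u_i, which vanish by affine
    independence; then u_0 = 0. *)
Lemma vertex_mx_unit : vertex_mx \in unitmx.
Proof.
rewrite -row_free_unit -kermx_eq0; apply/rowV0P => u /sub_kermxP.
rewrite vertex_mx_sum => e0.
have [e1 e2] : (\sum_i u 0 i)%:M = 0 :> 'rV[R]_1 /\ \sum_i u 0 i *: V i = 0.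
  by apply: eq_row_mx; rewrite e0 row_mx0.
have {}e1 : \sum_i u 0 i = 0.
  by have /matrixP/(_ 0 0) := e1; rewrite !mxE mulr1n.
pose w : 'rV[R]_d := \row_i u 0 (lift ord0 i).
have : w *m (\matrix_(i < d) (V (lift ord0 i) - V ord0)) = 0 *m
    (\matrix_(i < d) (V (lift ord0 i) - V ord0)).
  rewrite mul0mx mulmx_sum_row.
  transitivity (\sum_i u 0 i *: (V i - V ord0)).
    rewrite big_ord_recl subrr scaler0 add0r; apply: eq_bigr => i _.
    by rewrite rowK mxE.
  under eq_bigr do rewrite scalerBr.
  by rewrite big_split /= e2 sumrN -scaler_suml e1 scale0r oppr0 addr0.
move/(row_free_inj hV)/rowP => w0.
have u0 i : u 0 (lift ord0 i) = 0 by have := w0 i; rewrite !mxE.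
apply/rowP => i; rewrite mxE; case: (unliftP ord0 i) => [j|] -> //.
by move: e1; rewrite big_ord_recl big1 ?addr0 // => j _; rewrite u0.
Qed.

Lemma bary_vertex i j : bary V i (V j) = (i == j)%:R.
Proof.
have -> : bary V i (V j) = (row_mx 1%:M (V j) *m invmx vertex_mx) 0 i by [].
have -> : row_mx 1%:M (V j) = row j vertex_mx by rewrite rowK.
by rewrite -row_mul mulmxV ?vertex_mx_unit // !mxE eq_sym.
Qed.

Lemma bary_mul x :
  (\row_i bary V i x : 'rV[R]_(1 + d)) *m vertex_mx = row_mx 1%:M x.
Proof.
rewrite -[RHS](mulmxKV vertex_mx_unit); congr (_ *m _).
by apply/rowP => i; rewrite mxE.
Qed.

Lemma sum_bary x : \sum_i bary V i x = 1.
Proof.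
have := bary_mul x; rewrite vertex_mx_sum => /eq_row_mx [/matrixP/(_ 0 0)].
rewrite !mxE !mulr1n => <- _; by apply: eq_bigr => i _; rewrite mxE.
Qed.

Lemma bary_combination x : \sum_i bary V i x *: V i = x.
Proof.
have := bary_mul x; rewrite vertex_mx_sum => /eq_row_mx [_ e].
rewrite -[RHS]e.
by apply: eq_bigr => i _; rewrite mxE.
Qed.

Lemma baryE i x : bary V i x = invmx vertex_mx (lshift d ord0) i +
  dot x (\row_j invmx vertex_mx (rshift 1 j) i).
Proof.
rewrite /bary -/vertex_mx mxE big_split_ord big_ord1 /= row_mxEl mxE eqxx mul1r.
by congr (_ + _); rewrite dotE; apply: eq_bigr => j _; rewrite row_mxEr !mxE.
Qed.

Lemma grad_baryE i :
  grad_bary V i = \row_j invmx vertex_mx (rshift 1 j) i.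
Proof.
apply/rowP => j; rewrite !mxE.
set g := RHS.
rewrite /derive; apply: cvg_lim => //.
(* As [bary V i] is affine, its difference quotient is constant for h != 0. *)
apply: (@cvg_trans _ ((fun=> g) @ (0 : R)^')); last exact: cvg_cst.
apply: near_eq_cvg; near=> h.
have h0 : h != 0 by near: h; exact: nbhs_dnbhs_neq.
rewrite /= addr0 !baryE dotZl dot0l addr0 addrC addKr.
rewrite /GRing.scale /= mulKf // dotE (bigD1 j) //= big1 ?addr0 => [|k kj].
  by rewrite !mxE !eqxx mul1r.
by rewrite !mxE (negPf kj) andbF mul0r.
Unshelve. all: by end_near.
Qed.

Lemma grad_bary_dot i x y :
  dot (grad_bary V i) (x - y) = bary V i x - bary V i y.
Proof. by rewrite grad_baryE !baryE dotC dotBl opprD addrACA subrr add0r. Qed.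

End Barycentric.

(** * Gradients against tangent spaces of faces *)

Section Tangent.
Variables (R : realType) (d : nat) (V : 'I_d.+1 -> 'rV[R]_d).
Hypothesis hV : affinely_independent V.
Variable t : forall s : nat, {set 'I_d.+1} -> s.-tuple 'rV[R]_d.
Hypothesis ht : forall (s : nat) (e : {set 'I_d.+1}), e \in subsimplices d s ->
  orthonormal_basis (tangent V e) (t s e).
Implicit Types (e f : {set 'I_d.+1}).

(** lambda_j vanishes at every vertex of e, so its gradient is normal to e. *)
Lemma dot_grad_tangent e j z :
  j \notin e -> z \in tangent V e -> dot (grad_bary V j) z = 0.
Proof.
move=> je; apply: dot_span0 => _ /allpairsP [[x y] /= [xe ye ->]].
rewrite grad_bary_dot !(bary_vertex hV).
have jF i : i \in e -> (j == i) = false by move=> ie; apply: contraNF je => /eqP ->.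
by rewrite !mem_enum in xe ye; rewrite !jF // subrr.
Qed.

Definition proj_grad e j : 'rV[R]_d :=
  orthoproj (tangent V (j |: e)) (grad_bary V j).

Lemma proj_gradP s e j : e \in subsimplices d s -> j \notin e ->
  proj_grad e j \in tangent V (j |: e) /\
  forall z, z \in tangent V (j |: e) -> dot (proj_grad e j) z = dot (grad_bary V j) z.
Proof.
move=> es je; apply: (orthoproj_basis _ (ht (s := s.+1) _)).
by rewrite inE cardsU1 je; move: es; rewrite inE => /eqP ->.
Qed.

Lemma tangentS e f : e \subset f -> (tangent V e <= tangent V f)%VS.
Proof.
move=> ef; apply: sub_span => _ /allpairsP [[x y] /= [xe ye ->]].
rewrite !mem_enum in xe ye; apply/allpairsP; exists (x, y); split => //=.
  by rewrite mem_enum (fintype.subsetP ef).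
by rewrite mem_enum (fintype.subsetP ef).
Qed.

Lemma dot_proj_grad_tangent s e j z : e \in subsimplices d s -> j \notin e ->
  z \in tangent V e -> dot (proj_grad e j) z = 0.
Proof.
move=> es je ze; have [_ ->] := proj_gradP es je.
  exact: dot_grad_tangent ze.
by apply: (subvP (tangentS _) _ ze); apply: finset.subsetUr.
Qed.

(** The projection is tangent to e + j, on which lambda_i is zero. *)
Lemma dot_grad_proj_grad s e i j : e \in subsimplices d s ->
  i \notin e -> j \notin e -> i != j -> dot (grad_bary V i) (proj_grad e j) = 0.
Proof.
move=> es ie je ij; have [pj _] := proj_gradP es je.
by apply: dot_grad_tangent pj; rewrite !inE negb_or ij.
Qed.

(** The pairing is the squared length of the projection, which is not zero because lambda_j rises
    from 0 to 1 along an edge from a vertex of e to vertex j. *)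
Lemma dot_grad_proj_grad_neq0 s e j : e \in subsimplices d s -> j \notin e ->
  dot (grad_bary V j) (proj_grad e j) != 0.
Proof.
move=> es je; have [pj pE] := proj_gradP es je.
rewrite -pE // dot_eq0; apply/eqP => p0.
have /card_gt0P [i ie] : (0 < #|e|)%N by move: es; rewrite inE => /eqP ->.
have ij : (j == i) = false by apply: contraNF je => /eqP ->.
have : dot (proj_grad e j) (V j - V i) = 1.
  rewrite pE; first by rewrite grad_bary_dot !(bary_vertex hV) eqxx ij subr0.
  apply: memv_span; apply/allpairsP; exists (j, i).
  by rewrite /= !mem_enum !inE eqxx ie orbT.
by rewrite p0 dot0l => /eqP; rewrite eq_sym oner_eq0.
Qed.

End Tangent.

(** * Shape forms and dual forms on a face *)

Section Labels.
Variable d : nat.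
Implicit Types (e f : {set 'I_d.+1}).

(* inl a stands for the a-th tangent vector of e, inr j for d lambda_j.       *)
Definition label := (nat + 'I_d.+1)%type.

Definition valid_label e (l : label) : bool :=
  match l with inl a => (a < #|e|.-1)%N | inr j => j \notin e end.

(** The wedge factors of an index in order. [shape_form] and [dof_form] share this list and differ
    only in the vector attached to a label. *)
Definition labels k (i : dofidx d k) : seq label :=
  [seq inl (val (idx_sg i a)) | a <- enum 'I_(idx_s i + k - idx_l i)] ++
  [seq inr j | j <- enum (idx_f i :\: idx_e i)].

Lemma card_subsimplex s e : e \in subsimplices d s -> #|e| = s.+1.
Proof. by rewrite inE => /eqP. Qed.

Lemma size_labels k (i : dofidx d k) : admissible i ->
  (size [seq idx_sg i a | a <- enum 'I_(idx_s i + k - idx_l i)] +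
  size (enum (idx_f i :\: idx_e i)) = k)%N.
Proof.
case/and5P => /card_subsimplex es /andP[l1 l2] /card_subsimplex fs ef _.
rewrite size_map size_enum_ord -cardE cardsD (finset.setIidPr ef) es fs.
by move: l1 l2; rewrite geq_max leq_min; lia.
Qed.

Lemma uniq_labels k (i : dofidx d k) : admissible i -> uniq (labels i).
Proof.
case/and5P => _ _ _ _ hs.
rewrite cat_uniq; apply/and3P; split.
- by rewrite map_inj_uniq ?enum_uniq // => x y [/val_inj/(Sigma_inj hs)].
- by apply/hasPn => _ /mapP [j _ ->]; apply/mapP => -[].
- by rewrite map_inj_uniq ?enum_uniq // => x y [].
Qed.

Lemma valid_labels k (i : dofidx d k) : admissible i ->
  {in labels i, forall l, valid_label (idx_e i) l}.
Proof.
case/and5P => /card_subsimplex es _ _ _ _ l; rewrite mem_cat => /orP[] /mapP [x].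
  by move=> _ ->; rewrite /= es.
by rewrite mem_enum !inE => /andP[xe _] ->.
Qed.

Lemma admissible_s k (i : dofidx d k) : admissible i -> idx_s i = #|idx_e i|.-1 :> nat.
Proof. by case/and5P => /card_subsimplex -> _ _ _ _. Qed.

(** For a fixed e, inclusion of the labels gives f in f' and an inclusion of the images of sigma. A
    larger f leaves fewer tangent factors, as the total is k, so both inclusions are equalities. *)
Lemma labels_inj k (i j : dofidx d k) : admissible i -> admissible j ->
  idx_e i = idx_e j -> {subset labels i <= labels j} -> i = j.
Proof.
move=> hi hj; have := admissible_s hi; have := admissible_s hj.
have si := size_labels hi; have sj := size_labels hj.
case: i j hi hj si sj => -[s l] [[e f] sg] [[s' l'] [[e' f'] sg']].
rewrite /labels /idx_s /idx_l /idx_e /idx_f /idx_sg /=.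
move=> hi hj si sj es' es ee; subst e'.
have {es es'} ss : s = s' by apply/val_inj; exact: etrans es (esym es').
subst s' => sub.
case/and5P: hi => /=; rewrite /idx_s /idx_l /idx_e /idx_f /idx_sg /= => es.
rewrite geq_max leq_min => /andP[/andP[_ kl] /andP[lk _]] /card_subsimplex fl ef hs.
case/and5P: hj => /=; rewrite /idx_s /idx_l /idx_e /idx_f /idx_sg /= => _.
rewrite geq_max leq_min => /andP[/andP[_ kl'] /andP[lk' _]] /card_subsimplex fl' ef' hs'.
have hf : f \subset f'.
  apply/fintype.subsetP => x xf; have [/(fintype.subsetP ef') //|xe] := boolP (x \in e).
  have := sub (inr x); rewrite !mem_cat [X in _ || X](_ : _ = true); last first.
    by apply: map_f; rewrite mem_enum !inE xe.
  rewrite orbT => /(_ isT)/orP[/mapP [] //|/mapP [y]].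
  by rewrite mem_enum !inE => /andP[_ yf'] [->].
have ll : (l <= l')%N by rewrite -ltnS -fl -fl' subset_leq_card.
pose X (m : nat) (h : {ffun 'I_m -> 'I_s}) := [seq val (h a) | a <- enum 'I_m].
have sX m h : size (X m h) = m by rewrite size_map size_enum_ord.
have hsg : {subset X _ sg <= X _ sg'}.
  move=> x xX; have := sub (inl x); rewrite !mem_cat [X in X || _](_ : _ = true).
    by move=> /(_ isT)/orP[/mapP [a _ [->]]|/mapP [] //]; apply: map_f; rewrite mem_enum.
  by case/mapP: xX => a _ ->; apply/mapP; exists a => //; rewrite mem_enum.
have uX : uniq (X _ sg).
  by rewrite map_inj_uniq ?enum_uniq // => x y /val_inj/(Sigma_inj hs).
have ll' : l = l'.
  apply/val_inj/eqP; rewrite eqn_leq ll /=.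
  have : (s + k - l <= s + k - l')%N by have := uniq_leq_size uX hsg; rewrite !sX.
  by move: lk lk'; clear; lia.
subst l'.
have ff : f = f' by apply/eqP; rewrite eqEcard hf fl fl' /=.
subst f'.
have -> // : sg = sg'.
apply: (Sigma_imset_inj hs hs'); apply/eqP.
rewrite eqEcard !card_imset ?leqnn ?andbT; try exact: Sigma_inj.
apply/fintype.subsetP => _ /imsetP [a _ ->].
have /hsg /mapP [b _ /val_inj ->] : val (sg a) \in X _ sg.
  by apply: map_f; rewrite mem_enum.
by apply: imset_f.
Qed.

(** Labels of a full basis of R^d, ordered so that an increasing selection of k of them is the label
    list of an index. *)
Definition all_labels e : seq label :=
  [seq inl a | a <- iota 0 #|e|.-1] ++ [seq inr j | j <- enum (~: e)].

Lemma size_all_labels e : (0 < #|e|)%N -> size (all_labels e) = d.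
Proof.
move=> e0; rewrite size_cat !size_map size_iota -cardE.
have := cardsC e; rewrite card_ord; lia.
Qed.

Lemma uniq_all_labels e : uniq (all_labels e).
Proof.
rewrite cat_uniq; apply/and3P; split.
- by rewrite map_inj_uniq ?iota_uniq // => x y [].
- by apply/hasPn => _ /mapP [j _ ->]; apply/mapP => -[].
- by rewrite map_inj_uniq ?enum_uniq // => x y [].
Qed.

Lemma valid_all_labels e : {in all_labels e, forall l, valid_label e l}.
Proof.
move=> l; rewrite mem_cat => /orP[] /mapP [x].
  by rewrite mem_iota => /andP[_ ?] ->.
by rewrite mem_enum !inE => xe ->.
Qed.

Lemma sorted_ltn_split (s : seq nat) m : sorted ltn s ->
  s = [seq n <- s | (n < m)%N] ++ [seq n <- s | (m <= n)%N].
Proof.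
elim: s => //= n s IH hs; have := IH (path_sorted hs).
case: (ltnP n m) => nm; first by move=> {1}->.
have /allP h := order_path_min ltn_trans hs.
move=> _; rewrite (_ : [seq _ <- s | (_ < m)%N] = [::]) /=; last first.
  apply/eqP; rewrite -[_ == _]negbK -has_filter; apply/hasPn => x /h /= nx.
  by rewrite -leqNgt ltnW // (leq_ltn_trans nm).
congr (_ :: _); apply/esym/all_filterP/allP => x /h /= nx.
by rewrite ltnW // (leq_ltn_trans nm).
Qed.

(** With s the dimension of e, the selected positions below s give sigma and those from s on give
    the vertices of f outside e. *)
Lemma exists_labels k e (sg : {ffun 'I_k -> 'I_d}) : (0 < #|e|)%N ->
  sg \in Sigma k d ->
  exists i : dofidx d k, [/\ admissible i, idx_e i = e &
    labels i = [seq nth (inl 0) (all_labels e) (sg a) | a <- enum 'I_k]].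
Proof.
move=> e0 hsg; pose s := #|e|.-1; pose c := enum (~: e).
have se : #|e| = s.+1 by rewrite prednK.
have ed : (#|e| <= d.+1)%N by apply: leq_trans (max_card _) _; rewrite card_ord.
have sc : (size c + s = d)%N.
  by have := size_all_labels e0; rewrite size_cat !size_map size_iota addnC.
pose ns := [seq val (sg a) | a <- enum 'I_k].
have ns_sorted : sorted ltn ns.
  rewrite sorted_map; apply: sub_sorted (sorted_enum_ord _) => i j.
  by move/SigmaP: hsg; apply.
have ns_lt n : n \in ns -> (n < d)%N by case/mapP => a _ ->; apply: ltn_ord.
have szns : size ns = k by rewrite size_map size_enum_ord.
have := sorted_ltn_split s ns_sorted.
set l1 := [seq n <- ns | (n < s)%N]; set l2 := [seq n <- ns | (s <= n)%N] => nsE.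
have l1_sorted : sorted ltn l1 := sorted_filter ltn_trans _ ns_sorted.
have l2_sorted : sorted ltn l2 := sorted_filter ltn_trans _ ns_sorted.
have l1_lt n : n \in l1 -> (n < s)%N by rewrite mem_filter => /andP[].
have l2_ge n : n \in l2 -> (s <= n < d)%N.
  by rewrite mem_filter => /andP[-> /ns_lt].
have sz12 : (size l1 + size l2 = k)%N by rewrite -size_cat -nsE.
have sz1 : (size l1 <= s)%N.
  rewrite -(size_iota 0 s); apply: uniq_leq_size => [|n /l1_lt].
    exact: (sorted_uniq ltn_trans ltnn l1_sorted).
  by rewrite mem_iota.
have auxc (n : nat) : (s <= n < d)%N -> (n - s < size c)%N by move: sc; clear; lia.
have auxs (m n : nat) : (s <= m)%N -> (m < n)%N -> (m - s < n - s)%N by clear; lia.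
pose J := [seq nth ord0 c (n - s) | n <- l2].
have J_sorted : sorted (fun i j : 'I_d.+1 => (i < j)%N) J.
  rewrite sorted_map; apply: (sub_in_sorted (P := [in l2])) l2_sorted.
    move=> x y /l2_ge xs /l2_ge ys /= xy.
    apply: (sorted_ltn_nth (leT := fun i j : 'I_d.+1 => (i < j)%N)).
    - by move=> ? ? ?; apply: ltn_trans.
    - exact: sorted_enum_ord.
    - exact: auxc.
    - exact: auxc.
    - by apply: auxs => //; case/andP: xs.
  by apply/allP.
have Je j : j \in J -> j \notin e.
  case/mapP => n /l2_ge ns' ->; rewrite -finset.in_setC -mem_enum mem_nth //; exact: auxc.
pose f := e :|: [set x in J].
have fe : enum (f :\: e) = J.
  apply: (@irr_sorted_eq _ (fun i j : 'I_d.+1 => (i < j)%N)) => //.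
  - by move=> ? ? ?; apply: ltn_trans.
  - by move=> ?; rewrite ltnn.
  - exact: sorted_enum_ord.
  move=> x; rewrite mem_enum !inE; case: (boolP (x \in J)) => [/Je ->|] //=.
    by rewrite orbT.
  by rewrite orbF andNb.
have cf : #|f| = (s + size l2).+1.
  have := cardsID e f; rewrite (cardE (f :\: e)) fe size_map.
  by rewrite (finset.setIidPr (finset.subsetUl _ _)) => <-; rewrite se addSn.
have fd : (#|f| <= d.+1)%N by apply: leq_trans (max_card _) _; rewrite card_ord.
have hs : (s < d.+1)%N by lia.
have hl : (s + size l2 < d.+1)%N by lia.
pose s' := Ordinal hs; pose l' := Ordinal hl.
have sz1' : (s' + k - l')%N = size l1 by rewrite /=; lia.
have tlt (a : 'I_(s' + k - l')) : (nth 0 l1 a < s')%N.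
  by apply: l1_lt; rewrite mem_nth // -sz1'.
pose tau : {ffun 'I_(s' + k - l') -> 'I_s'} := [ffun a => Ordinal (tlt a)].
exists (existT (fun p : 'I_d.+1 * 'I_d.+1 =>
    ({set 'I_d.+1} * {set 'I_d.+1} * {ffun 'I_(p.1 + k - p.2) -> 'I_p.1})%type)
  (s', l') (e, f, tau)).
split=> //.
  apply/and5P; rewrite /idx_s /idx_l /idx_e /idx_f /idx_sg /=; split.
  - by rewrite inE se.
  - by rewrite geq_max leq_min; apply/andP; split; apply/andP; split; lia.
  - by rewrite inE cf.
  - exact: finset.subsetUl.
  - apply/SigmaP => a b ab; rewrite !ffunE /=.
    by apply: (sorted_ltn_nth ltn_trans) => //; rewrite inE -sz1'.
rewrite /labels /idx_s /idx_l /idx_e /idx_f /idx_sg /= fe.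
transitivity (map (nth (inl 0) (all_labels e)) ns); last by rewrite -map_comp.
rewrite nsE map_cat; congr (_ ++ _).
  transitivity [seq (inl n : label) | n <- map (nth 0 l1) (map val (enum 'I_(s' + k - l')))] => //.
    by rewrite -!map_comp; apply: eq_map => a /=; rewrite ffunE.
  rewrite val_enum_ord sz1' map_nth_iota0 // take_size; apply/eq_in_map => n /l1_lt ns'.
  by rewrite nth_cat size_map size_iota ns' (nth_map 0) ?size_iota // nth_iota.
rewrite -map_comp; apply/eq_in_map => n /l2_ge /andP[sn nd].
rewrite nth_cat size_map size_iota ltnNge sn /= (nth_map ord0) //.
by apply: auxc; rewrite sn.
Qed.

End Labels.

(** * Gram matrices of shape forms and dual forms *)

Section Gram.
Variables (R : realType) (d : nat) (V : 'I_d.+1 -> 'rV[R]_d).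
Hypothesis hV : affinely_independent V.
Variable t : forall s : nat, {set 'I_d.+1} -> s.-tuple 'rV[R]_d.
Hypothesis ht : forall (s : nat) (e : {set 'I_d.+1}), e \in subsimplices d s ->
  orthonormal_basis (tangent V e) (t s e).
Implicit Types (e f : {set 'I_d.+1}).

Definition shape_vec e (l : label d) : 'rV[R]_d :=
  match l with inl a => nth 0 (t #|e|.-1 e) a | inr j => grad_bary V j end.

(** Up to nonzero factors, on valid labels, the basis dual to [shape_vec e]. *)
Definition dof_vec e (l : label d) : 'rV[R]_d :=
  match l with inl a => nth 0 (t #|e|.-1 e) a | inr j => proj_grad V e j end.

Lemma tangent_vectorsE k (i : dofidx d k) (F : label d -> 'rV[R]_d) :
  admissible i -> (forall a, F (inl a) = nth 0 (t #|idx_e i|.-1 (idx_e i)) a) ->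
  tangent_vectors t i ++ [seq F (inr j) | j <- enum (idx_f i :\: idx_e i)] =
  map F (labels i).
Proof.
move=> hi hF; rewrite /tangent_vectors map_cat -!map_comp; congr (_ ++ _).
apply: eq_map => a /=; rewrite hF (tnth_nth 0) /=.
by rewrite -(admissible_s hi).
Qed.

Lemma shape_formE k (i : dofidx d k) : admissible i ->
  shape_form V t i = @detform R d (map (shape_vec (idx_e i)) (labels i)) k.
Proof.
move=> hi; rewrite /shape_form altcast_altwedge_wedges.
  by rewrite -(tangent_vectorsE hi).
by rewrite -[RHS](size_labels hi) !size_map.
Qed.

Lemma dof_formE k (i : dofidx d k) : admissible i ->
  dof_form V t i = @detform R d (map (dof_vec (idx_e i)) (labels i)) k.
Proof.
move=> hi; rewrite /dof_form altcast_altwedge_wedges.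
  by rewrite -(tangent_vectorsE hi).
by rewrite -[RHS](size_labels hi) !size_map.
Qed.

(** The tangent vectors are orthonormal; gradients and projected gradients at vertices outside e are
    normal to e; among themselves they pair diagonally. *)
Lemma shape_dof_dot e l l' : (0 < #|e|)%N -> valid_label e l -> valid_label e l' ->
  (dot (shape_vec e l) (dof_vec e l') == 0) = (l != l').
Proof.
move=> e0; have es : e \in subsimplices d #|e|.-1 by rewrite inE prednK.
have [/andP[/eqP bt _] ot] := ht es.
have tT a : (a < #|e|.-1)%N -> nth 0 (t #|e|.-1 e) a \in tangent V e.
  by move=> ha; rewrite -bt; apply/memv_span/mem_nth; rewrite size_tuple.
case: l l' => [a|i] [b|j] /= hl hl'.
- have := ot (Ordinal hl) (Ordinal hl'); rewrite !(tnth_nth 0) /= => ->.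
  by rewrite pnatr_eq0 eqb0 -val_eqE.
- by rewrite dotC (dot_proj_grad_tangent hV ht es) ?eqxx // tT.
- by rewrite (dot_grad_tangent hV hl) ?eqxx // tT.
rewrite -[inr i == inr j]/(i == j); have [->|ij] := eqVneq i j.
  by rewrite (negPf (dot_grad_proj_grad_neq0 hV ht es hl')).
by rewrite (dot_grad_proj_grad hV ht es) ?eqxx.
Qed.

Lemma rowsmx_mul (us vs : seq 'rV[R]_d) k (i j : 'I_k) :
  (rowsmx us k *m (rowsmx vs k)^T) i j = dot (nth 0 us i) (nth 0 vs j) :> R.
Proof. by rewrite dotE mxE; apply: eq_bigr => x _; rewrite !mxE. Qed.

Lemma gram_neq0 e k (L : seq (label d)) : (0 < #|e|)%N -> size L = k -> uniq L ->
  {in L, forall l, valid_label e l} ->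
  \det (rowsmx (map (shape_vec e) L) k *m (rowsmx (map (dof_vec e) L) k)^T) != 0.
Proof.
move=> e0 sL uL vL; set A := _ *m _.
have AE i j : (A i j == 0) = (i != j).
  rewrite rowsmx_mul !(nth_map (inl 0)) ?sL ?ltn_ord //.
  by rewrite shape_dof_dot // ?vL ?mem_nth ?sL ?ltn_ord // nth_uniq ?sL.
rewrite det_trig; last first.
  by apply/is_trig_mxP => i j ij; apply/eqP; rewrite AE neq_ltn ij.
by apply/prodf_neq0 => i _; rewrite AE negbK.
Qed.

(** A label of [L] missing from [L'] produces a zero row. *)
Lemma gram_eq0 e k (L L' : seq (label d)) : (0 < #|e|)%N ->
  size L = k -> size L' = k -> ~ {subset L <= L'} ->
  {in L, forall l, valid_label e l} -> {in L', forall l, valid_label e l} ->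
  \det (rowsmx (map (shape_vec e) L) k *m (rowsmx (map (dof_vec e) L') k)^T) = 0.
Proof.
move=> e0 sL sL' nsub vL vL'.
have [l lL lL'] : exists2 l, l \in L & l \notin L'.
  by apply/allPn; apply/negP => /allP.
have hl : (index l L < k)%N by rewrite -sL index_mem.
apply/eqP/det0P; exists (delta_mx 0 (Ordinal hl)).
  apply/eqP => /matrixP/(_ 0 (Ordinal hl)); rewrite !mxE !eqxx => /eqP.
  by rewrite oner_eq0.
rewrite -rowE; apply/rowP => j; rewrite mxE rowsmx_mul mxE /=.
rewrite !(nth_map (inl 0)) ?sL ?sL' ?ltn_ord // nth_index //.
have lj : nth (inl 0) L' j \in L' by rewrite mem_nth ?sL'.
apply/eqP; rewrite (shape_dof_dot e0 (vL _ lL) (vL' _ lj)).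
by apply: contraNneq lL' => ->.
Qed.

(** By [labels_inj], distinct indices on one face never have nested label lists, so [gram_eq0]
    applies off the diagonal and [gram_neq0] on it. *)
Lemma altdot_shape_dof k (i j : dofidx d k) : admissible i -> admissible j ->
  idx_e i = idx_e j ->
  (altdot (shape_form V t i) (dof_form V t j) == 0) = (i != j).
Proof.
move=> hi hj ee; rewrite shape_formE // dof_formE // altdot_det.
have e0 : (0 < #|idx_e j|)%N by case/and5P: hj => /card_subsimplex ->.
have szl (x : dofidx d k) : admissible x -> size (labels x) = k.
  by move=> /size_labels; rewrite size_cat !size_map.
rewrite -ee; have [->|ij] /= := eqVneq i j.
  by apply/negbTE/gram_neq0; rewrite ?szl ?uniq_labels //; apply: valid_labels.
apply/eqP/gram_eq0; rewrite ?ee ?szl //.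
- by move/(labels_inj hi hj ee)/eqP; rewrite (negPf ij).
- by rewrite -ee; apply: valid_labels.
- exact: valid_labels.
Qed.

(** The matrix [U] of the full basis attached to e is invertible. Writing A = (A U^T) U^-T,
    Cauchy-Binet expands [a] along the k-minors of A U^T, and these minors are the shape forms. *)
Lemma Alt_shape_span k e (a : 'M[R]_(k, d) -> R) : (0 < #|e|)%N -> Alt k a ->
  exists (n : nat) (c : 'I_n -> R) (i : 'I_n -> dofidx d k),
    (forall j, admissible (i j) /\ idx_e (i j) = e) /\
    forall A, a A = \sum_j c j * shape_form V t (i j) A.
Proof.
move=> e0 aA.
have sz := size_all_labels e0.
pose L := all_labels e; pose U := rowsmx (map (shape_vec e) L) d.
have Uu : U \in unitmx.
  have := gram_neq0 e0 sz (uniq_all_labels e) (@valid_all_labels _ e).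
  by rewrite det_mulmx mulf_eq0 negb_or unitmxE unitfE => /andP[].
pose Sg := Sigma k d.
have /fin_all_exists [i iP] (j : 'I_#|Sg|) : exists i : dofidx d k,
    [/\ admissible i, idx_e i = e & labels i =
      [seq nth (inl 0) L (enum_val j a) | a <- enum 'I_k]].
  exact: exists_labels e0 (enum_valP j).
exists #|Sg|, (fun j => a (rowsub (enum_val (j : 'I_#|Sg|) : {ffun 'I_k -> 'I_d}) (invmx U^T))), i.
split=> [j|A]; first by have [] := iP j.
rewrite -[A](mulmxK (_ : U^T \in unitmx)) ?unitmx_tr // (Alt_Cauchy_Binet _ _ aA).
rewrite (mulmxK (_ : U^T \in unitmx)) ?unitmx_tr // big_enum_val /=.
apply: eq_bigr => j _; rewrite mulrC; congr (_ * _).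
have [hi ei li] := iP j; rewrite shape_formE // ei li; congr (\det _).
apply/matrixP => x y; rewrite !mxE; apply: eq_bigr => z _; rewrite !mxE.
by rewrite -map_comp (nth_map x) ?size_enum_ord //= (nth_map (inl 0)) ?sz // nth_ord_enum.
Qed.

End Gram.

(** * Polynomials in Bernstein form *)

Section PolyClosure.
Variables (R : realType) (d : nat).
Implicit Types p q : 'rV[R]_d -> R.

Lemma Poly_cst r (c : R) : Defs.Poly r (fun _ : 'rV[R]_d => c).
Proof.
exists (mpolyC d c); last by apply/funext => x; rewrite mevalC.
by rewrite msizeC; case: eqP.
Qed.

Lemma PolyD r p q : Defs.Poly r p -> Defs.Poly r q -> Defs.Poly r (fun x => p x + q x).
Proof.
move=> [p' sp ->] [q' sq ->]; exists (p' + q').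
  by rewrite (leq_trans (msizeD_le _ _)) // geq_max sp sq.
by apply/funext => x; rewrite mevalD.
Qed.

Lemma PolyM r s p q : Defs.Poly r p -> Defs.Poly s q -> Defs.Poly (r + s) (fun x => p x * q x).
Proof.
move=> [p' sp ->] [q' sq ->]; exists (p' * q').
  have [->|p0] := eqVneq p' 0; first by rewrite mul0r msize0.
  have [->|q0] := eqVneq q' 0; first by rewrite mulr0 msize0.
  by rewrite msizeM //; move: (msize p') (msize q') sp sq; clear; lia.
by apply/funext => x; rewrite mevalM.
Qed.

Lemma Poly_sum r (I : Type) (s : seq I) (P : pred I) (F : I -> 'rV[R]_d -> R) :
  (forall i, P i -> Defs.Poly r (F i)) -> Defs.Poly r (fun x => \sum_(i <- s | P i) F i x).
Proof.
move=> h; elim: s => [|i s IH].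
  by under eq_fun do rewrite big_nil; exact: Poly_cst.
under eq_fun do rewrite big_cons.
by case Pi: (P i) => //; apply: PolyD => //; exact: h.
Qed.

Lemma Poly_prod (I : Type) (s : seq I) (P : pred I) (r : I -> nat)
    (F : I -> 'rV[R]_d -> R) :
  (forall i, P i -> Defs.Poly (r i) (F i)) ->
  Defs.Poly (\sum_(i <- s | P i) r i)%N (fun x => \prod_(i <- s | P i) F i x).
Proof.
move=> h; elim: s => [|i s IH].
  rewrite big_nil (_ : (fun x => _) = fun=> 1); first exact: Poly_cst.
  by apply/funext => x; rewrite big_nil.
rewrite big_cons (_ : (fun x => _) = fun x => if P i then
    F i x * \prod_(j <- s | P j) F j x else \prod_(j <- s | P j) F j x).
  2: by apply/funext => x; rewrite big_cons.
by case Pi: (P i) => //; apply: PolyM => //; exact: h.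
Qed.

Lemma PolyX r n p : Defs.Poly r p -> Defs.Poly (r * n) (fun x => p x ^+ n).
Proof.
move=> h; elim: n => [|n IH].
  by under eq_fun do rewrite expr0; exact: Poly_cst.
by under eq_fun do rewrite exprS; rewrite mulnS; apply: PolyM.
Qed.

Lemma Poly_coord i : Defs.Poly 1 (fun x : 'rV[R]_d => x 0 i).
Proof.
exists (mpolyX R (mnm1 i)); last by apply/funext => x; rewrite mevalXU.
by rewrite msizeX mdeg1.
Qed.

Lemma PolyForm0 r k : PolyForm r k (0 : 'rV[R]_d -> 'M[R]_(k, d) -> R).
Proof.
exists 0, (fun=> fun=> 0), (fun=> fun=> 0); split=> [[]|[]|] //.
by apply/funext => x; apply/funext => A; rewrite big_ord0.
Qed.

Lemma PolyFormD r k (om om' : 'rV[R]_d -> 'M[R]_(k, d) -> R) :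
  PolyForm r k om -> PolyForm r k om' -> PolyForm r k (om + om').
Proof.
move=> [n [p [a [hp ha ->]]]] [n' [p' [a' [hp' ha' ->]]]].
exists (n + n')%N.
exists (fun j => match fintype.split j with inl i => p i | inr i => p' i end).
exists (fun j => match fintype.split j with inl i => a i | inr i => a' i end).
split=> [j|j|]; try by case: fintype.split.
apply/funext => x; apply/funext => A; rewrite big_split_ord /=.
congr (_ + _); apply: eq_bigr => j _.
  by rewrite (unsplitK (inl j)).
by rewrite (unsplitK (inr j)).
Qed.

End PolyClosure.

Section BernsteinForms.
Variables (R : realType) (d : nat) (V : 'I_d.+1 -> 'rV[R]_d).
Implicit Types (e : {set 'I_d.+1}) (p q : 'rV[R]_d -> R).

Lemma Poly_bary i : Defs.Poly 1 (bary V i).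
Proof.
rewrite (_ : bary V i = fun x => invmx (vertex_mx V) (lshift d ord0) i +
  \sum_j x 0 j * invmx (vertex_mx V) (rshift 1 j) i).
  apply: PolyD; first exact: Poly_cst.
  apply: Poly_sum => j _; rewrite -[1%N]/(1 + 0)%N; apply: PolyM.
    exact: Poly_coord.
  exact: Poly_cst.
apply/funext => x; rewrite baryE dotE; congr (_ + _).
by apply: eq_bigr => j _; rewrite mxE.
Qed.

Lemma Poly_monomial e al : Defs.Poly (\sum_(i in e) al i) (monomial V e al).
Proof.
apply: Poly_prod => i _; rewrite -[X in Defs.Poly X]mul1n; apply: PolyX.
exact: Poly_bary.
Qed.

Lemma bubbleE e : bubble V e = monomial V e (fun=> 1%N).
Proof. by []. Qed.

Lemma monomialM e al be x :
  monomial V e al x * monomial V e be x = monomial V e (fun i => al i + be i)%N x.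
Proof. by rewrite -big_split; apply: eq_bigr => i _; rewrite exprD. Qed.

Lemma monomial_supp e al x : (forall i, i \notin e -> al i = 0%N) ->
  monomial V [set: _] al x = monomial V e al x.
Proof.
move=> h; rewrite /monomial (bigID [in e]) /= [X in _ * X]big1 ?mulr1.
  by apply: eq_bigl => i; rewrite !inE.
by move=> i /andP[_ /h ->].
Qed.

Lemma PolySub0 m e : PolySub V m e (fun=> 0).
Proof.
case: m => [m|m] //=; exists 0, (fun=> 0), (fun=> fun=> 0%N); split=> [[]|] //.
by apply/funext => x; rewrite big_ord0.
Qed.

Lemma PolySubD m e p q : PolySub V m e p -> PolySub V m e q ->
  PolySub V m e (fun x => p x + q x).
Proof.
case: m => [m|m] /=; last by move=> -> ->; apply/funext => x; rewrite addr0.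
move=> [n [c [al [ha ->]]]] [n' [c' [al' [ha' ->]]]].
exists (n + n')%N.
exists (fun j => match fintype.split j with inl i => c i | inr i => c' i end).
exists (fun j => match fintype.split j with inl i => al i | inr i => al' i end).
split=> [j|]; first by case: fintype.split.
apply/funext => x; rewrite big_split_ord /=.
congr (_ + _); apply: eq_bigr => j _.
  by rewrite (unsplitK (inl j)).
by rewrite (unsplitK (inr j)).
Qed.

Lemma PolySub_sum m e (I : Type) (s : seq I) (P : pred I) (F : I -> 'rV[R]_d -> R) :
  (forall i, P i -> PolySub V m e (F i)) ->
  PolySub V m e (fun x => \sum_(i <- s | P i) F i x).
Proof.
move=> h; elim: s => [|i s IH].
  by under eq_fun do rewrite big_nil; exact: PolySub0.
under eq_fun do rewrite big_cons.
by case Pi: (P i) => //; apply: PolySubD => //; exact: h.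
Qed.

Lemma PolySub_monomial m e al (c : R) : (\sum_(i in e) al i)%N = m ->
  PolySub V (Posz m) e (fun x => c * monomial V e al x).
Proof.
by exists 1%N, (fun=> c), (fun=> al); split=> //; apply/funext => x; rewrite big_ord1.
Qed.

Lemma PolySubM m n e p q : PolySub V (Posz m) e p -> PolySub V (Posz n) e q ->
  PolySub V (Posz (m + n)) e (fun x => p x * q x).
Proof.
move=> [n1 [c [al [ha ->]]]] [n2 [c' [al' [ha' ->]]]].
under eq_fun do rewrite big_distrl.
apply: PolySub_sum => i _; under eq_fun do rewrite big_distrr.
apply: PolySub_sum => j _ /=.
rewrite (_ : (fun x => _) = fun x =>
    c i * c' j * monomial V e (fun l => al i l + al' j l)%N x); last first.
  by apply/funext => x; rewrite mulrACA monomialM.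
by apply: PolySub_monomial; rewrite big_split ha ha'.
Qed.

Lemma PolySub_Poly m e p : PolySub V (Posz m) e p -> Defs.Poly m p.
Proof.
move=> [n [c [al [ha ->]]]]; apply: Poly_sum => j _.
by rewrite -(ha j) -[X in Defs.Poly X]add0n; apply: PolyM;
  [exact: Poly_cst | exact: Poly_monomial].
Qed.

Hypothesis hV : affinely_independent V.

Lemma PolySub_coord j : PolySub V (Posz 1) [set: _] (fun x => x 0 j).
Proof.
rewrite (_ : (fun x => _) = 
  fun x => \sum_i V i 0 j * monomial V [set: _] (fun l => (l == i) : nat) x).
  apply: PolySub_sum => i _; apply: PolySub_monomial.
  by rewrite (bigD1 i) ?inE //= eqxx big1 // => l /andP[_ /negPf ->].
apply/funext => x; rewrite -[in LHS](bary_combination hV x) summxE.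
apply: eq_bigr => i _; rewrite mxE mulrC; congr (_ * _).
rewrite /monomial (bigD1 i) ?inE //= eqxx big1 ?mulr1 // => l /andP[_ /negPf ->].
by rewrite expr0.
Qed.

(** The partition of unity, used to raise the Bernstein degree. *)
Lemma PolySub_1 : PolySub V (Posz 1) [set: _] (fun=> 1).
Proof.
rewrite (_ : (fun x => _) = fun x => \sum_i 1 * monomial V [set: _] (fun l => (l == i) : nat) x).
  apply: PolySub_sum => i _; apply: PolySub_monomial.
  by rewrite (bigD1 i) ?inE //= eqxx big1 // => l /andP[_ /negPf ->].
apply/funext => x; rewrite -[in LHS](sum_bary hV x).
apply: eq_bigr => i _; rewrite mul1r.
rewrite /monomial (bigD1 i) ?inE //= eqxx big1 ?mulr1 // => l /andP[_ /negPf ->].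
by rewrite expr0.
Qed.

Lemma PolySub_cst0 (c : R) e : PolySub V (Posz 0) e (fun=> c).
Proof.
rewrite (_ : (fun=> c) = fun x => c * monomial V e (fun=> 0%N) x).
  by apply: PolySub_monomial; rewrite big1.
by apply/funext => x; rewrite /monomial big1 ?mulr1 // => i _; rewrite expr0.
Qed.

Lemma PolySubX m n e p : PolySub V (Posz m) e p ->
  PolySub V (Posz (m * n)) e (fun x => p x ^+ n).
Proof.
move=> h; elim: n => [|n IH].
  by under eq_fun do rewrite expr0; rewrite muln0; exact: PolySub_cst0.
by under eq_fun do rewrite exprS; rewrite mulnS; apply: PolySubM.
Qed.

Lemma PolySub_prod e (I : Type) (s : seq I) (r : I -> nat)
    (F : I -> 'rV[R]_d -> R) :
  (forall i, PolySub V (Posz (r i)) e (F i)) ->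
  PolySub V (Posz (\sum_(i <- s) r i)%N) e (fun x => \prod_(i <- s) F i x).
Proof.
move=> h; elim: s => [|i s IH].
  rewrite big_nil (_ : (fun x => _) = fun=> 1); first exact: PolySub_cst0.
  by apply/funext => x; rewrite big_nil.
rewrite big_cons (_ : (fun x => _) = fun x => F i x * \prod_(j <- s) F j x).
  exact: PolySubM.
by apply/funext => x; rewrite big_cons.
Qed.

(** Homogenisation: each coordinate is a linear form in the lambda_i, and a monomial of lower degree
    is multiplied by a power of 1 = sum lambda_i to reach degree r. *)
Lemma Poly_PolySub r p : Defs.Poly r p -> PolySub V (Posz r) [set: _] p.
Proof.
move=> [q sq ->]; under eq_fun do rewrite mevalE big_seq.
apply: PolySub_sum => m mq.
have mr : (mdeg m <= r)%N.
  by rewrite -ltnS; apply: leq_trans sq; exact: msize_mdeg_lt.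
rewrite (_ : (fun x => _) = fun x : 'rV[R]_d =>
  (mcoeff m q * \prod_i x 0 i ^+ m i) * 1 ^+ (r - mdeg m)); last first.
  by apply/funext => x; rewrite expr1n mulr1.
rewrite -[X in Posz X](subnKC mr); apply: PolySubM; last first.
  by rewrite -[X in Posz X]mul1n; apply: PolySubX; exact: PolySub_1.
rewrite -[X in Posz X]add0n; apply: PolySubM; first exact: PolySub_cst0.
rewrite mdegE; apply: PolySub_prod => i.
by rewrite -[X in Posz X]mul1n; apply: PolySubX; exact: PolySub_coord.
Qed.

End BernsteinForms.

(** * The sum of the components *)

Section Decomposition.
Variables (R : realType) (d : nat) (V : 'I_d.+1 -> 'rV[R]_d).
Hypothesis hV : affinely_independent V.
Variable t : forall s : nat, {set 'I_d.+1} -> s.-tuple 'rV[R]_d.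
Hypothesis ht : forall (s : nat) (e : {set 'I_d.+1}), e \in subsimplices d s ->
  orthonormal_basis (tangent V e) (t s e).
Variables (k r : nat).
Implicit Types (e : {set 'I_d.+1}).
Implicit Types (om : 'rV[R]_d -> 'M[R]_(k, d) -> R).

Lemma coef_space_pos (i : dofidx d k) : (idx_s i < r)%N ->
  coef_space V i r = PolySub V (Posz (r - (idx_s i).+1)) (idx_e i).
Proof. by move=> h; rewrite /coef_space subzn. Qed.

Lemma coef_space_neg (i : dofidx d k) : (r <= idx_s i)%N -> coef_space V i r = [set fun=> 0].
Proof.
move=> h; rewrite /coef_space (_ : _ - _ = Negz (idx_s i - r)) //.
by rewrite NegzE -subSn // -subzn ?opprB // leqW.
Qed.

Lemma component0 (i : dofidx d k) : component V t i r 0.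
Proof.
exists (fun=> 0); first exact: PolySub0.
by apply/funext => x; apply/funext => A; rewrite mulr0 mul0r.
Qed.

Lemma componentD (i : dofidx d k) om om' : component V t i r om -> component V t i r om' ->
  component V t i r (om + om').
Proof.
move=> [p hp ->] [p' hp' ->]; exists (fun x => p x + p' x).
  exact: PolySubD.
by apply/funext => x; apply/funext => A; rewrite mulrDr mulrDl.
Qed.

Lemma component_PolyForm (i : dofidx d k) om : admissible i -> component V t i r om ->
  PolyForm r k om.
Proof.
move=> hi [p hp ->].
exists 1%N, (fun=> fun x => bubble V (idx_e i) x * p x), (fun=> shape_form V t i).
split=> [_|_|]; last by apply/funext => x; apply/funext => A; rewrite big_ord1.
  case: (ltnP (idx_s i) r) => h; last first.
    move: hp; rewrite coef_space_neg // => ->.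
    by under eq_fun do rewrite mulr0; exact: Poly_cst.
  have /card_subsimplex es : idx_e i \in subsimplices d (idx_s i) by case/and5P: hi.
  rewrite -(subnKC h) -es -sum1_card.
  apply: PolyM; first exact: Poly_monomial.
  by rewrite sum1_card es; apply: (@PolySub_Poly _ _ V _ (idx_e i)); rewrite -coef_space_pos.
by rewrite shape_formE //; exact: Alt_det.
Qed.

(** The set that [direct_sum] compares with the whole space. *)
Definition component_sums : set ('rV[R]_d -> 'M[R]_(k, d) -> R) :=
  [set u | exists2 w : dofidx d k -> _,
       forall i : dofidx d k, admissible i -> component V t i r (w i) &
     u = \sum_(i | admissible i) w i].

Lemma component_sums0 : component_sums 0.
Proof.
by exists (fun=> 0) => [i _|]; [exact: component0 | rewrite big1].
Qed.

Lemma component_sumsD om om' : component_sums om -> component_sums om' ->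
  component_sums (om + om').
Proof.
move=> [w hw ->] [w' hw' ->]; exists (fun i => w i + w' i).
  by move=> i hi; apply: componentD; [exact: hw | exact: hw'].
by rewrite big_split.
Qed.

Lemma component_sums_sum (I : Type) (s : seq I) (F : I -> _) :
  (forall j, component_sums (F j)) -> component_sums (\sum_(j <- s) F j).
Proof.
move=> h; elim: s => [|j s IH]; rewrite ?big_nil ?big_cons.
  exact: component_sums0.
exact: component_sumsD.
Qed.

Lemma component_sums_component (i : dofidx d k) om : admissible i -> component V t i r om ->
  component_sums om.
Proof.
move=> hi h; exists (fun j => if j == i then om else 0).
  by move=> j hj; case: eqP => [->//|_]; exact: component0.
by rewrite (bigD1 i) //= eqxx big1 ?addr0 // => j /andP[_ /negPf ->].
Qed.

(** On the support e of alpha every lambda_i occurs at least once, so b_e factors out. *)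
Lemma monomial_bubble (al : 'I_d.+1 -> nat) (e := [set i | al i != 0%N]%SET) x :
  monomial V [set: _]%SET al x = bubble V e x * monomial V e (fun i => (al i).-1) x.
Proof.
rewrite bubbleE monomialM (@monomial_supp _ _ _ e) => [|i].
  by apply: eq_bigr => i; rewrite inE => h; rewrite add1n prednK // lt0n.
by rewrite inE negbK => /eqP.
Qed.

Lemma sum_predn (al : 'I_d.+1 -> nat) (e := [set i | al i != 0%N]%SET) :
  (#|e| + \sum_(i in e) (al i).-1 = \sum_i al i)%N.
Proof.
rewrite -sum1_card -big_split /= [RHS](bigID [in e]) /= [X in (_ + X)%N]big1.
  rewrite addn0; apply: eq_bigr => i.
  by rewrite inE => h; rewrite add1n prednK // lt0n.
by move=> i; rewrite inE negbK => /eqP.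
Qed.

Hypothesis hr : (0 < r)%N.

Lemma component_sums_monomial (al : 'I_d.+1 -> nat) (c : R) a :
  (\sum_i al i)%N = r -> Alt k a ->
  component_sums (fun x A => c * monomial V [set: _]%SET al x * a A).
Proof.
move=> hal aA; pose e := [set i | al i != 0%N]%SET.
have er : (#|e| + \sum_(i in e) (al i).-1 = r)%N by rewrite -hal; exact: sum_predn.
(* As r >= 1, the support is nonempty and hence a face. *)
have e0 : (0 < #|e|)%N.
  rewrite lt0n; apply: contraTneq hr => /cards0_eq e0.
  by rewrite -er e0 big_set0 cards0.
have [n [c' [i [hi aE]]]] := Alt_shape_span hV ht e0 aA.
rewrite (_ : (fun x => _) = \sum_j fun x A =>
   bubble V e x * (c * c' j * monomial V e (fun i => (al i).-1) x) *
     shape_form V t (i j) A).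
  apply: component_sums_sum => j; have [hj ej] := hi j.
  apply: (component_sums_component hj).
  exists (fun x => c * c' j * monomial V e (fun i => (al i).-1) x); last by rewrite ej.
  have sj : #|e| = (idx_s (i j)).+1.
    by rewrite -ej; apply: card_subsimplex; case/and5P: hj.
  rewrite coef_space_pos ?ej; last by rewrite -sj -er leq_addr.
  by apply: PolySub_monomial; rewrite -sj -[in RHS]er addKn.
rewrite fct_sumE; apply/funext => x; rewrite fct_sumE; apply/funext => A.
rewrite aE monomial_bubble -/e big_distrr /=; apply: eq_bigr => j _.
by ring.
Qed.

Lemma PolyForm_component_sums om : PolyForm r k om -> component_sums om.
Proof.
move=> [n [p [a [hp ha ->]]]].
rewrite (_ : (fun x => _) = \sum_j fun x A => p j x * a j A); last first.
  by rewrite fct_sumE; apply/funext => x; rewrite fct_sumE.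
apply: component_sums_sum => j.
have [m [c [al [hal ->]]]] := Poly_PolySub hV (hp j).
rewrite (_ : (fun x => _) = \sum_l fun x A =>
    c l * monomial V [set: _]%SET (al l) x * a j A); last first.
  rewrite fct_sumE; apply/funext => x; rewrite fct_sumE.
  by apply/funext => A; rewrite big_distrl.
apply: component_sums_sum => l; apply: component_sums_monomial => //.
by rewrite -(hal l); apply: eq_bigl => i; rewrite inE.
Qed.

Lemma component_sumsE : component_sums = PolyForm r k.
Proof.
apply/seteqP; split=> om; last exact: PolyForm_component_sums.
move=> [w hw ->]; apply: (big_ind (PolyForm r k)).
- exact: PolyForm0.
- exact: PolyFormD.
- by move=> i hi; apply: (component_PolyForm hi); exact: hw.
Qed.

End Decomposition.

(** * Integrals of polynomials over the corner *)

Section PolynomialIntegral.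
Variable R : realType.
Implicit Types (p P : {poly R}) (a b : R).
Local Notation mu := (@lebesgue_measure R).

Lemma poly_infinite_roots p (f : nat -> R) :
  injective f -> (forall n, p.[f n] = 0) -> p = 0.
Proof.
move=> fi h; apply: contraTeq isT => p0.
have /= := max_poly_roots p0 (rs := [seq f n | n <- iota 0 (size p)]).
rewrite size_map size_iota ltnn => -> //.
  by apply/allP => _ /mapP [n _ ->]; apply/eqP.
by rewrite map_inj_uniq ?iota_uniq.
Qed.

Lemma Rintegral_poly P a b : a <= b ->
  \int[mu]_(x in `[a, b]) P^`().[x] = P.[b] - P.[a].
Proof.
rewrite le_eqVlt => /predU1P[->|ab].
  by rewrite subrr set_itv1 Rintegral_set1.
have cP x : {for x, continuous (horner P)} by exact: continuous_horner.
rewrite /Rintegral (@continuous_FTC2 _ _ (horner P)) //.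
- by apply: continuous_subspaceT => x; exact: continuous_horner.
- split=> [x _||]; first exact: derivable_horner.
    by apply: cvg_at_right_filter; exact: cP.
  by apply: cvg_at_left_filter; exact: cP.
- by move=> x _; rewrite derivE.
Qed.

Lemma poly_primitive p : exists P, P^`() = p.
Proof.
exists (\sum_(i < size p) (p`_i / i.+1%:R) *: 'X^(i.+1)).
rewrite raddf_sum -[RHS]coefK poly_def; apply: eq_bigr => i _.
rewrite /= derivZ derivXn /= -scalerMnr scalerMnl -[X in X *: _]mulr_natr.
by rewrite divfK // pnatr_eq0.
Qed.

(* A primitive is nondecreasing with equal values at 0 and a.                 *)
Lemma Rintegral_poly_eq0 p a : 0 < a ->
  (forall x, 0 <= x <= a -> 0 <= p.[x]) ->
  \int[mu]_(x in `[0, a]) p.[x] = 0 -> p = 0.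
Proof.
move=> a0; have [P <-] := poly_primitive p => pge0.
rewrite Rintegral_poly ?ltW // => Pa.
suff -> : P = P.[0]%:P by rewrite derivC.
apply/eqP; rewrite -subr_eq0; apply/eqP.
(* At each point y = a / (n + 1), P(0) <= P(y) <= P(a) = P(0), so P - P(0) has infinitely many
   roots. *)
apply: (@poly_infinite_roots _ (fun n => a / n.+1%:R)) => [m n|n].
  move/(mulfI (lt0r_neq0 a0))/invr_inj/eqP.
  by rewrite eqr_nat eqSS => /eqP.
set y := _ / _; have y0 : 0 <= y by rewrite divr_ge0 // ltW.
have ya : y <= a by rewrite ler_pdivrMr ?ltr0n // ler_peMr ?ler1n // ltW.
rewrite hornerD hornerN hornerC.
have h1 : 0 <= P.[y] - P.[0].
  rewrite -Rintegral_poly //; apply: Rintegral_ge0 => x /=.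
  by rewrite in_itv /= => /andP[x0 xy]; rewrite pge0 // x0 (le_trans xy).
have h2 : 0 <= P.[a] - P.[y].
  rewrite -Rintegral_poly //; apply: Rintegral_ge0 => x /=.
  by rewrite in_itv /= => /andP[x0 xy]; rewrite pge0 // xy (le_trans y0).
lra.
Qed.

(* The integral of x^m (a - x)^n over [0, a] is K a^(m + n + 1).              *)
Lemma beta_primitive m n : exists K : R, forall a, exists P : {poly R},
  [/\ P^`() = 'X^m * (a%:P - 'X) ^+ n, P.[0] = 0 & P.[a] = K * a ^+ (m + n).+1].
Proof.
(* Coefficients from expanding (a - x)^n and integrating termwise; they are independent of a. *)
pose c i : R := (-1) ^+ i * 'C(n, i)%:R / (m + i).+1%:R.
exists (\sum_(i < n.+1) c i) => a.
exists (\sum_(i < n.+1) (a ^+ (n - i) * c i) *: 'X^((m + i).+1)); split.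
- rewrite raddf_sum exprBn big_distrr /=; apply: eq_bigr => i _.
  rewrite /= derivZ derivXn /= -scalerMnr scalerMnl -[X in X *: _]mulr_natr /c.
  rewrite mulrA divfK ?pnatr_eq0 //.
  rewrite exprD -mul_polyC -[_ *+ 'C(n, i)]mulr_natr !polyCM !polyC_exp polyCN polyC1 polyC_natr.
  ring.
- by rewrite horner_sum big1 // => i _; rewrite hornerZ hornerXn expr0n mulr0.
- rewrite horner_sum big_distrl /=; apply: eq_bigr => i _.
  rewrite hornerZ hornerXn mulrAC -exprD mulrC; congr (_ * _ ^+ _).
  have := ltn_ord i; lia.
Qed.

End PolynomialIntegral.

Section CornerIntegral.
Variable R : realType.

Lemma row_mx_head s (y : R) (z : 'rV[R]_s) :
  (row_mx (y%:M : 'rV[R]_1) z : 'rV[R]_s.+1) 0 ord0 = y.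
Proof.
have -> : ord0 = lshift s (0 : 'I_1) by apply/val_inj.
by rewrite (row_mxEl (y%:M : 'rV[R]_1) z) mxE eqxx.
Qed.

Lemma row_mx_tail s (y : R) (z : 'rV[R]_s) i :
  (row_mx (y%:M : 'rV[R]_1) z : 'rV[R]_s.+1) 0 (lift ord0 i) = z 0 i.
Proof. rewrite -rshift1; exact: (row_mxEr (y%:M : 'rV[R]_1) z). Qed.

Lemma corner_integral_ge0 s (a : R) (g : 'rV[R]_s -> R) : 0 <= a ->
  (forall y : 'rV[R]_s, (forall j, 0 <= y 0 j) -> \sum_j y 0 j <= a -> 0 <= g y) ->
  0 <= corner_integral a g.
Proof.
elim: s a g => [|s IH] a g a0 g0 /=.
  by apply: g0 => [[]|] //; rewrite big_ord0.
apply: Rintegral_ge0 => y /=; rewrite in_itv /= => /andP[y0 ya].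
apply: IH => [|z z0 za]; first by rewrite subr_ge0.
apply: g0 => [j|].
  by case: (unliftP ord0 j) => [l|] ->; rewrite ?row_mx_head ?row_mx_tail.
rewrite big_ord_recl row_mx_head; under eq_bigr do rewrite row_mx_tail.
by rewrite addrC -lerBrDr.
Qed.

Lemma row_mx_monomial s (y : R) (z : 'rV[R]_s) (be : 'I_s.+1 -> nat) :
  \prod_i (row_mx (y%:M : 'rV[R]_1) z : 'rV[R]_s.+1) 0 i ^+ be i =
  y ^+ be ord0 * \prod_i z 0 i ^+ be (lift ord0 i).
Proof.
rewrite big_ord_recl row_mx_head; congr (_ * _).
by apply: eq_bigr => i _; rewrite row_mx_tail.
Qed.

(** By induction the inner integral over the slice at y is a multiple of a power of a - y, so the
    outer one is a beta integral. The constant depends on the exponents only, and finite sums are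
    treated at once so that no separate additivity of the iterated integral is needed. *)
Lemma corner_integral_monomials s : exists C : ('I_s -> nat) -> R,
  forall (a : R) (I : Type) (r : seq I) (c : I -> R) (be : I -> 'I_s -> nat),
    0 <= a ->
    corner_integral a (fun y : 'rV[R]_s =>
       \sum_(j <- r) c j * \prod_i y 0 i ^+ be j i) =
    \sum_(j <- r) c j * C (be j) * a ^+ (\sum_i be j i + s).
Proof.
elim: s => [|s [C IH]].
  exists (fun=> 1) => a I r c be a0 /=; apply: eq_bigr => j _.
  by rewrite !big_ord0 expr0 !mulr1.
have /choice[K /= hK] : forall q : nat * nat, exists K : R, forall a,
    exists P : {poly R}, [/\ P^`() = 'X^(q.1) * (a%:P - 'X) ^+ q.2, P.[0] = 0 &
      P.[a] = K * a ^+ (q.1 + q.2).+1].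
  by move=> [m n]; exact: beta_primitive.
pose be' (be : 'I_s.+1 -> nat) i := be (lift ord0 i).
pose N be := (\sum_i be' be i + s)%N.
exists (fun be => C (be' be) * K (be ord0, N be)) => a I r c be a0.
have /choice[Q hQ] := fun j => hK (be j ord0, N (be j)) a.
pose P := \sum_(j <- r) (c j * C (be' (be j))) *: Q j.
transitivity (\int[@lebesgue_measure R]_(y in `[0, a]) P^`().[y]).
  apply: eq_Rintegral.
  move=> y; rewrite inE /= in_itv /= => /andP[y0 ya].
  transitivity (corner_integral (a - y) (fun z : 'rV[R]_s =>
      \sum_(j <- r) (c j * y ^+ be j ord0) * \prod_i z 0 i ^+ be' (be j) i)).
    congr corner_integral; apply/funext => z; apply: eq_bigr => j _.
    by rewrite row_mx_monomial mulrA.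
  rewrite IH ?subr_ge0 // /P raddf_sum horner_sum; apply: eq_bigr => j _.
  rewrite /= derivZ hornerZ; have [-> _ _] := hQ j.
  by rewrite hornerM hornerXn horner_exp !hornerE /=; ring.
rewrite Rintegral_poly // /P !horner_sum -sumrB; apply: eq_bigr => j _.
rewrite !hornerZ; have [_ -> ->] := hQ j.
rewrite mulr0 subr0 /= !mulrA; congr (_ * _ ^+ _).
by rewrite /N big_ord_recl addnS addnA.
Qed.

(** The integral over the slice at first coordinate x is a nonnegative polynomial in x with zero
    integral, hence is zero; induction then applies to each slice. *)
Lemma corner_integral_eq0 s (a : R) (I : Type) (r : seq I) (c : I -> R)
    (be : I -> 'I_s -> nat)
    (g := fun y : 'rV[R]_s => \sum_(j <- r) c j * \prod_i y 0 i ^+ be j i) :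
  0 < a ->
  (forall y : 'rV[R]_s, (forall j, 0 <= y 0 j) -> \sum_j y 0 j <= a -> 0 <= g y) ->
  corner_integral a g = 0 ->
  forall y : 'rV[R]_s, (forall j, 0 < y 0 j) -> \sum_j y 0 j < a -> g y = 0.
Proof.
rewrite {}/g; elim: s a c be => [|s IH] a c be a0 g0 int0 y y0 ya.
  by rewrite (thinmx0 y) -[RHS]int0.
pose c' (y : R) j := c j * y ^+ be j ord0.
pose be' j i := be j (lift ord0 i).
have slice (x : R) (z : 'rV[R]_s) :
    \sum_(j <- r) c j * \prod_i (row_mx (x%:M : 'rV[R]_1) z : 'rV[R]_s.+1) 0 i ^+ be j i =
    \sum_(j <- r) c' x j * \prod_i z 0 i ^+ be' j i.
  by apply: eq_bigr => j _; rewrite row_mx_monomial mulrA.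
have slice_ge0 (x : R) : 0 <= x <= a -> forall z : 'rV[R]_s,
    (forall j, 0 <= z 0 j) -> \sum_j z 0 j <= a - x ->
    0 <= \sum_(j <- r) c' x j * \prod_i z 0 i ^+ be' j i.
  move=> /andP[x0 xa] z z0 za; rewrite -slice; apply: g0 => [j|].
    by case: (unliftP ord0 j) => [l|] ->; rewrite ?row_mx_head ?row_mx_tail.
  rewrite big_ord_recl row_mx_head; under eq_bigr do rewrite row_mx_tail.
  by rewrite addrC -lerBrDr.
have [C hC] := corner_integral_monomials s.
pose P : {poly R} := \sum_(j <- r) (c j * C (be' j)) *:
  ('X^(be j ord0) * (a%:P - 'X) ^+ (\sum_i be' j i + s)).
have PE (x : R) : 0 <= x <= a ->
    P.[x] = corner_integral (a - x) (fun z : 'rV[R]_s =>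
      \sum_(j <- r) c' x j * \prod_i z 0 i ^+ be' j i).
  move=> /andP[x0 xa]; rewrite hC ?subr_ge0 // horner_sum; apply: eq_bigr => j _.
  by rewrite hornerZ hornerM hornerXn horner_exp !hornerE /c' /=; ring.
have P0 : P = 0.
  apply: (Rintegral_poly_eq0 a0) => [x xa|].
    rewrite PE //; apply: corner_integral_ge0; last exact: slice_ge0.
    by rewrite subr_ge0; case/andP: xa.
  rewrite -[RHS]int0 /=; apply: eq_Rintegral => x; rewrite inE /= in_itv /= => xa.
  by rewrite PE //; congr corner_integral; apply/funext => z; rewrite slice.
pose z : 'rV[R]_s := \row_i y 0 (lift ord0 i).
have -> : y = row_mx ((y 0 ord0)%:M : 'rV[R]_1) z.
  apply/rowP => j; case: (unliftP ord0 j) => [l|] ->.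
    by rewrite row_mx_tail mxE.
  by rewrite row_mx_head.
have yE : \sum_j y 0 j = y 0 ord0 + \sum_j z 0 j.
  by rewrite big_ord_recl; congr (_ + _); apply: eq_bigr => j _; rewrite mxE.
have z_ge0 : 0 <= \sum_j z 0 j by apply: sumr_ge0 => j _; rewrite mxE ltW.
have ya0 : y 0 ord0 < a by rewrite (le_lt_trans _ ya) // yE lerDl.
have y0a : 0 <= y 0 ord0 <= a by rewrite !ltW.
rewrite slice; apply: (IH (a - y 0 ord0)).
- by rewrite subr_gt0.
- exact: slice_ge0.
- by rewrite -PE // P0 horner0.
- by move=> j; rewrite mxE.
- by rewrite ltrBrDl -yE.
Qed.

(* Homogeneity extends the vanishing to the open orthant of R^e, where        *)
(* mu + x lies for all large real x, so that g (mu + x) is the zero polynomial.*)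
Lemma homogeneous_eq0 n (e : {set 'I_n}) m (I : finType) (c : I -> R)
    (al : I -> 'I_n -> nat)
    (g := fun mu : 'I_n -> R => \sum_j c j * \prod_(i in e) mu i ^+ al j i) :
  (0 < #|e|)%N -> (forall j, \sum_(i in e) al j i = m)%N ->
  (forall mu, (forall i, i \in e -> 0 < mu i) -> \sum_(i in e) mu i = 1 -> g mu = 0) ->
  forall mu, g mu = 0.
Proof.
move=> e0 hal h mu.
have hom (x : R) nu : g (fun i => x * nu i) = x ^+ m * g nu.
  rewrite /g big_distrr; apply: eq_bigr => j _ /=.
  rewrite mulrCA -(hal j) -prodrXr -big_split /=; congr (_ * _).
  by apply: eq_bigr => i _; rewrite exprMn.
have pos nu : (forall i, i \in e -> 0 < nu i) -> g nu = 0.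
  move=> nu0; set S := \sum_(i in e) nu i.
  have S0 : 0 < S.
    have [i ie] := card_gt0P e0; rewrite /S (bigD1 i) //=.
    rewrite ltr_pwDl ?nu0 // sumr_ge0 // => j /andP[je _]; exact/ltW/nu0.
  have -> : nu = fun i => S * (nu i / S).
    by apply/funext => i; rewrite mulrC divfK // gt_eqF.
  rewrite hom h ?mulr0 // => [i ie|]; first by rewrite divr_gt0 // nu0.
  by rewrite -mulr_suml divff // gt_eqF.
pose P : {poly R} := \sum_j c j *: \prod_(i in e) ('X + (mu i)%:P) ^+ al j i.
have PE x : P.[x] = g (fun i => x + mu i).
  rewrite horner_sum; apply: eq_bigr => j _; rewrite hornerZ horner_prod.
  by congr (_ * _); apply: eq_bigr => i _; rewrite horner_exp !hornerE.
pose N := \sum_(i in e) `|mu i|.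
have P0 : P = 0.
  (* [N] dominates every |mu_i|, so these points make all x + mu_i positive. *)
  apply: (@poly_infinite_roots _ _ (fun n => N + n.+1%:R)) => [i j|i].
    by move/addrI/eqP; rewrite eqr_nat eqSS => /eqP.
  rewrite PE pos // => j je; rewrite /N (bigD1 j) //=.
  have h1 : 0 <= \sum_(i0 in e | i0 != j) `|mu i0| by apply: sumr_ge0.
  have h2 : 0 < i.+1%:R :> R by rewrite ltr0n.
  have h3 : 0 <= `|mu j| + mu j by rewrite -lerBlDr sub0r -normrN ler_norm.
  by move: h1 h2 h3; set A := \sum_(_ in _ | _) _; lra.
have := PE 0; rewrite P0 horner0 => /esym <-.
by congr g; apply/funext => i; rewrite add0r.
Qed.

End CornerIntegral.

(** * Faces parametrised by the corner *)

Section PolyIntegral.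
Variables (R : realType) (s : nat).

Lemma Poly_le d m n (p : 'rV[R]_d -> R) : (m <= n)%N -> Defs.Poly m p -> Defs.Poly n p.
Proof. by move=> mn [q hq ->]; exists q => //; apply: leq_trans hq _. Qed.

Lemma Poly_affine d n (p : 'rV[R]_d -> R) (v : 'rV[R]_d) (E : 'M[R]_(s, d)) :
  Defs.Poly n p -> Defs.Poly n (fun y => p (v + y *m E)).
Proof.
move=> [q hq ->]; under eq_fun do rewrite mevalE big_seq.
apply: Poly_sum => m mq; apply: (@Poly_le _ (mdeg m)).
  by rewrite -ltnS; apply: leq_trans hq; exact: msize_mdeg_lt.
rewrite -[mdeg m]add0n; apply: PolyM; first exact: Poly_cst.
rewrite mdegE; apply: Poly_prod => i _; rewrite -[X in Defs.Poly X]mul1n.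
apply: PolyX; rewrite (_ : (fun y => _) = fun y : 'rV[R]_s =>
  v 0 i + \sum_j y 0 j * E j i); last by apply/funext => y; rewrite !mxE.
apply: (@Poly_le _ 1) => //; apply: PolyD; first exact: Poly_cst.
apply: Poly_sum => j _; rewrite -[1%N]/(1 + 0)%N; apply: PolyM.
  exact: Poly_coord.
exact: Poly_cst.
Qed.

Lemma Poly_monomials n (g : 'rV[R]_s -> R) : Defs.Poly n g ->
  exists r : seq (R * ('I_s -> nat)),
    g = fun y => \sum_(j <- r) j.1 * \prod_i y 0 i ^+ j.2 i.
Proof.
move=> [q _ ->]; exists [seq (mcoeff m q, fun i => m i) | m <- msupp q].
by apply/funext => y; rewrite big_map mevalE.
Qed.

(** Read off the explicit values on monomials, whence the restriction to polynomials. *)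
Lemma corner_integralB n (a : R) (g h : 'rV[R]_s -> R) : 0 <= a ->
  Defs.Poly n g -> Defs.Poly n h ->
  corner_integral a (fun y => g y - h y) = corner_integral a g - corner_integral a h.
Proof.
move=> a0 /Poly_monomials [r ->] /Poly_monomials [r' ->].
have [C hC] := corner_integral_monomials R s.
have -> : (fun y : 'rV[R]_s => \sum_(j <- r) j.1 * \prod_i y 0 i ^+ j.2 i -
      \sum_(j <- r') j.1 * \prod_i y 0 i ^+ j.2 i) =
    fun y => \sum_(j <- r ++ [seq (- j.1, j.2) | j <- r']) j.1 * \prod_i y 0 i ^+ j.2 i.
  apply/funext => y; rewrite big_cat big_map -sumrN; congr (_ + _).
  by apply: eq_bigr => j _; rewrite mulNr.
rewrite !hC // big_cat big_map -sumrN; congr (_ + _).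
by apply: eq_bigr => j _; rewrite !mulNr.
Qed.

End PolyIntegral.

Section Parametrisation.
Variables (R : realType) (d : nat) (V : 'I_d.+1 -> 'rV[R]_d).
Hypothesis hV : affinely_independent V.
Variables (s : nat) (e : {set 'I_d.+1}).
Hypothesis es : e \in subsimplices d s.
Let v m := nth ord0 (enum e) m.
Let pt (y : 'rV[R]_s) := V (v 0) + y *m edges V s e.

Let size_e : size (enum e) = s.+1.
Proof. by rewrite -cardE; apply: card_subsimplex. Qed.

Lemma bary_point i y : bary V i (pt y) =
  (i == v 0)%:R + \sum_(j < s) y 0 j * ((i == v j.+1)%:R - (i == v 0)%:R).
Proof.
apply/eqP; rewrite -[X in X + _](bary_vertex hV) addrC -subr_eq; apply/eqP.
rewrite -grad_bary_dot /pt addrC addKr mulmx_sum_row dot_sumr.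
apply: eq_bigr => j _; rewrite dotZr rowK grad_bary_dot.
by rewrite !(bary_vertex hV).
Qed.

Lemma bary_point_notin i y : i \notin e -> bary V i (pt y) = 0.
Proof.
move=> ie; have vF m : (m < s.+1)%N -> (i == v m) = false.
  by move=> ms; apply: contraNF ie => /eqP ->; rewrite -mem_enum mem_nth ?size_e.
rewrite bary_point vF // big1 ?addr0 // => j _.
by rewrite !vF ?subrr ?mulr0 // ltnS.
Qed.

Lemma bary_point0 y : bary V (v 0) (pt y) = 1 - \sum_j y 0 j.
Proof.
rewrite bary_point eqxx -sumrN; congr (_ + _); apply: eq_bigr => j _.
by rewrite nth_uniq ?size_e ?enum_uniq // ?ltnS // sub0r mulrN1.
Qed.

Lemma bary_pointS (l : 'I_s) y : bary V (v l.+1) (pt y) = y 0 l.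
Proof.
rewrite bary_point nth_uniq ?size_e ?enum_uniq // ?ltnS // add0r.
rewrite (bigD1 l) //= eqxx subr0 mulr1 big1 ?addr0 // => j jl.
rewrite nth_uniq ?size_e ?enum_uniq // ?ltnS // eqSS subr0.
by rewrite [_ == _](_ : _ = false) ?mulr0 //; apply/negbTE; rewrite eq_sym.
Qed.

Lemma vertexP i : i \in e -> i = v 0 \/ exists l : 'I_s, i = v l.+1.
Proof.
rewrite -mem_enum => /(nthP ord0) [[|m]]; rewrite size_e ltnS => hm <-.
  by left.
by right; exists (Ordinal hm).
Qed.

(** The Gram determinant is a sum of squares by [altdot_det]. A kernel vector y gives y E = 0, so
    [pt y] is the first vertex of e, and its barycentric coordinates force y = 0. *)
Lemma det_edges_gt0 : 0 < \det (edges V s e *m (edges V s e)^T).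
Proof.
rewrite lt0r; apply/andP; split; last first.
  rewrite -altdot_det; apply: sumr_ge0 => sg _.
  by rewrite -expr2 sqr_ge0.
apply/det0P => -[y y0]; rewrite mulmxA => /(congr1 (fun A => A *m y^T)).
rewrite mul0mx -mulmxA -trmx_mul => /matrixP/(_ 0 0); rewrite [RHS]mxE => /eqP.
rewrite -[_ 0 0]/(dot _ _) dot_eq0 => /eqP E0.
case/eqP: y0; apply/rowP => l; rewrite -bary_pointS /pt E0 addr0 (bary_vertex hV).
by rewrite nth_uniq ?size_e ?enum_uniq // ?ltnS // mxE.
Qed.

Lemma subsimplex_integral_eq0 g : (subsimplex_integral V s e g == 0) =
  (corner_integral 1 (fun y => g (pt y)) == 0).
Proof. by rewrite mulf_eq0 gt_eqF // sqrtr_gt0 det_edges_gt0. Qed.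

Lemma sum_enum_vertices (mu : 'I_d.+1 -> R) :
  \sum_(i in e) mu i = mu (v 0) + \sum_(l < s) mu (v l.+1).
Proof.
rewrite -big_enum (big_nth ord0) size_e big_mkord big_ord_recl.
by congr (_ + _).
Qed.

(** The integrand b_e (C p)^2 is nonnegative on e, so it vanishes in the open face, where b_e > 0.
    Thus p is zero there and, being homogeneous in the lambda_i, everywhere on R^d. *)
Lemma bubble_square_eq0 m (p : 'rV[R]_d -> R) (C : R) : C != 0 ->
  PolySub V (Posz m) e p ->
  subsimplex_integral V s e (fun x => bubble V e x * p x * C * (C * p x)) = 0 ->
  p = fun=> 0.
Proof.
move=> C0 hp /eqP; rewrite subsimplex_integral_eq0 => /eqP int0.
pose g y := bubble V e (pt y) * p (pt y) * C * (C * p (pt y)).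
have [n gn] : exists n, Defs.Poly n g.
  exists (\sum_(i in e) 1 + m + 0 + (0 + m))%N.
  apply: (@Poly_affine _ _ _ _ (fun x => bubble V e x * p x * C * (C * p x))).
  do !apply: PolyM; try exact: Poly_cst; try exact: PolySub_Poly hp.
  exact: Poly_monomial.
have [r gE] := Poly_monomials gn.
have gF y : g y = bubble V e (pt y) * (C * p (pt y)) ^+ 2 by rewrite /g; ring.
have pt0 (y : 'rV[R]_s) : (forall l, 0 < y 0 l) -> \sum_l y 0 l < 1 -> p (pt y) = 0.
  move=> y0 y1; have : g y = 0.
    rewrite gE; apply: (@corner_integral_eq0 _ _ 1 _ r) y0 y1 => //; last by rewrite -gE.
    move=> z z0 z1; rewrite -(congr1 (@^~ z) gE) gF mulr_ge0 ?sqr_ge0 //.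
    apply: prodr_ge0 => i /vertexP [->|[l ->]].
      by rewrite bary_point0 subr_ge0.
    by rewrite bary_pointS.
  rewrite gF => /eqP; rewrite mulf_eq0 sqrf_eq0 mulf_eq0 (negPf C0) /=.
  case/orP => [|/eqP //]; rewrite gt_eqF // prodr_gt0 // => i /vertexP [->|[l ->]].
    by rewrite bary_point0 subr_gt0.
  by rewrite bary_pointS.
case: hp => n' [c [al [hal pE]]].
have := @homogeneous_eq0 R _ e m _ c al; rewrite (card_subsimplex es) => H.
rewrite pE; apply/funext => x; apply: H => //= mu mu0 mu1.
(* Positive weights of sum 1 are the barycentric coordinates of a point of the open face. *)
pose y : 'rV[R]_s := \row_l mu (v l.+1).
have ve k : (k < s.+1)%N -> v k \in e by move=> ?; rewrite -mem_enum mem_nth ?size_e.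
have hy : \sum_l y 0 l = 1 - mu (v 0).
  rewrite -mu1 sum_enum_vertices addrC addKr.
  by apply: eq_bigr => l _; rewrite mxE.
have h0 : p (pt y) = 0.
  apply: pt0 => [l|]; first by rewrite mxE mu0 // ve // ltnS.
  by rewrite hy ltrBlDr ltrDl mu0 // ve.
rewrite -[RHS]h0 pE; apply: eq_bigr => j _; congr (_ * _).
apply: eq_bigr => i /vertexP [->|[l ->]]; first by rewrite bary_point0 hy subKr.
by rewrite bary_pointS mxE.
Qed.

Lemma subsimplex_integralB n g h : Defs.Poly n g -> Defs.Poly n h ->
  subsimplex_integral V s e (fun x => g x - h x) =
  subsimplex_integral V s e g - subsimplex_integral V s e h.
Proof.
move=> gn hn; rewrite /subsimplex_integral -mulrBr; congr (_ * _).
by apply: (@corner_integralB _ _ n) => //; exact: Poly_affine.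
Qed.

End Parametrisation.

(** * Unisolvence *)

Section AltdotLinear.
Variables (R : realType) (d k : nat).
Implicit Types a b : 'M[R]_(k, d) -> R.

Lemma altdot_suml (I : Type) (r : seq I) (P : pred I) (F : I -> 'M[R]_(k, d) -> R) b :
  altdot (fun A => \sum_(i <- r | P i) F i A) b = \sum_(i <- r | P i) altdot (F i) b.
Proof.
rewrite /altdot exchange_big /=; apply: eq_bigr => sg _.
by rewrite big_distrl.
Qed.

Lemma altdotZl (c : R) a b : altdot (fun A => c * a A) b = c * altdot a b.
Proof. by rewrite /altdot big_distrr; apply: eq_bigr => sg _; rewrite /= mulrA. Qed.

Lemma altdotBl a a' b : altdot (a - a') b = altdot a b - altdot a' b.
Proof. by rewrite /altdot -sumrB; apply: eq_bigr => sg _; rewrite -mulrBl. Qed.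

Lemma PolyForm_altdot r (om : 'rV[R]_d -> 'M[R]_(k, d) -> R) b :
  PolyForm r k om -> Defs.Poly r (fun x => altdot (om x) b).
Proof.
move=> [n [p [a [hp _ ->]]]]; apply: Poly_sum => sg _.
rewrite -[r]addn0; apply: PolyM; last exact: Poly_cst.
apply: Poly_sum => j _; rewrite -[r]addn0; apply: PolyM => //.
exact: Poly_cst.
Qed.

Lemma PolyFormN r (om : 'rV[R]_d -> 'M[R]_(k, d) -> R) :
  PolyForm r k om -> PolyForm r k (- om).
Proof.
move=> [n [p [a [hp ha ->]]]]; exists n, (fun j x => -1 * p j x), a; split=> // [j|].
  by rewrite -[r]add0n; apply: PolyM; first exact: Poly_cst.
apply/funext => x; apply/funext => A; rewrite -[LHS]/(- _) -sumrN.
by apply: eq_bigr => j _; rewrite mulN1r mulNr.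
Qed.

End AltdotLinear.

Section Unisolvence.
Variables (R : realType) (d : nat) (V : 'I_d.+1 -> 'rV[R]_d).
Hypothesis hV : affinely_independent V.
Variable t : forall s : nat, {set 'I_d.+1} -> s.-tuple 'rV[R]_d.
Hypothesis ht : forall (s : nat) (e : {set 'I_d.+1}), e \in subsimplices d s ->
  orthonormal_basis (tangent V e) (t s e).
Variables (k r : nat).
Implicit Types (om : 'rV[R]_d -> 'M[R]_(k, d) -> R).

Lemma coef_spaceZ (i : dofidx d k) (c : R) p :
  coef_space V i r p -> coef_space V i r (fun x => c * p x).
Proof.
rewrite /coef_space; case: (_ - _) => [m|m]; last first.
  by move=> /= ->; apply/funext => x; rewrite mulr0.
move=> hp; rewrite -[X in PolySub _ (Posz X)]add0n; apply: PolySubM => //.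
exact: PolySub_cst0.
Qed.

Lemma componentN (i : dofidx d k) om : component V t i r om -> component V t i r (- om).
Proof.
move=> [p hp ->]; exists (fun x => -1 * p x); first exact: coef_spaceZ.
by apply/funext => x; apply/funext => A; rewrite mulN1r mulrN mulNr.
Qed.

Lemma coef_space_Poly (i : dofidx d k) p : coef_space V i r p -> Defs.Poly r p.
Proof.
have [h|h] := ltnP (idx_s i) r; last first.
  by rewrite coef_space_neg // => ->; exact: Poly_cst.
rewrite coef_space_pos // => /PolySub_Poly; apply: Poly_le; exact: leq_subr.
Qed.

Lemma dofB (i : dofidx d k) q om om' : admissible i -> coef_space V i r q ->
  PolyForm r k om -> PolyForm r k om' ->
  dof V t i q (om - om') = dof V t i q om - dof V t i q om'.
Proof.
move=> hi hq h h'; have es : idx_e i \in subsimplices d (idx_s i) by case/and5P: hi.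
rewrite /dof -(@subsimplex_integralB _ _ _ _ _ (r + r)).
- congr subsimplex_integral; apply/funext => x.
  by rewrite -[(om - om') x]/(om x - om' x) altdotBl mulrBl.
- by apply: PolyM; [exact: PolyForm_altdot | exact: coef_space_Poly hq].
- by apply: PolyM; [exact: PolyForm_altdot | exact: coef_space_Poly hq].
Qed.

(* Restricted to e, only the components on faces of e survive; those on       *)
(* proper faces vanish by induction, and the rest is diagonal in the dofs.    *)
Lemma components_eq0 (w : dofidx d k -> 'rV[R]_d -> 'M[R]_(k, d) -> R) :
  (forall i, admissible i -> component V t i r (w i)) ->
  (forall i, admissible i -> forall q, coef_space V i r q ->
     dof V t i q (\sum_(j | admissible j) w j) = 0) ->
  forall i, admissible i -> w i = 0.
Proof.
move=> hw h; suff H n i : admissible i -> (idx_s i < n)%N -> w i = 0.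
  by move=> i hi; apply: (H (idx_s i).+1).
elim: n i => // n IH i hi; rewrite ltnS leq_eqVlt => /predU1P[sn|]; last exact: IH.
have es : idx_e i \in subsimplices d (idx_s i) by case/and5P: hi.
have [p hp wE] := hw i hi.
pose C := altdot (shape_form V t i) (dof_form V t i).
have C0 : C != 0 by rewrite /C altdot_shape_dof // eqxx.
suff p0 : p = fun=> 0.
  by rewrite wE p0; apply/funext => x; apply/funext => A; rewrite mulr0 mul0r.
have [sr|sr] := ltnP (idx_s i) r; last by move: hp; rewrite coef_space_neg.
have hp' := hp; rewrite coef_space_pos // in hp'.
apply: (bubble_square_eq0 hV es C0 hp').
(* The test function is q = C p, with C the diagonal Gram entry. *)
have := h i hi _ (coef_spaceZ C hp); rewrite /dof => <-.
congr (_ * corner_integral _ _); apply/funext => y.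
set x := _ + _; congr (_ * _).
rewrite fct_sumE fct_sumE altdot_suml (bigD1 i) //= big1 ?addr0.
  by rewrite wE altdotZl.
move=> j /andP[hj ji]; have [q hq wjE] := hw j hj.
(* On the same face, distinct indices are orthogonal to the dual form of i. *)
have [ej|ej] := eqVneq (idx_e j) (idx_e i).
  rewrite wjE altdotZl (_ : altdot _ _ = 0) ?mulr0 //.
  by apply/eqP; rewrite altdot_shape_dof.
have [sj|sj] := ltnP (idx_s j) (idx_s i).
  rewrite (IH j hj) -?sn // /altdot big1 // => sg _.
  by rewrite mul0r.
(* A different face of dimension at least that of e has a vertex outside e, so its bubble vanishes
   on e. *)
have [l lj li] : exists2 l, l \in idx_e j & l \notin idx_e i.
  apply/subsetPn; apply: contra ej => sub; rewrite eqEcard sub.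
  rewrite (card_subsimplex es) (@card_subsimplex _ (idx_s j)) ?ltnS //.
  by case/and5P: hj.
rewrite wjE altdotZl /bubble (bigD1 l) //= bary_point_notin //.
by rewrite !mul0r.
Qed.

End Unisolvence.

Theorem theorem5p2 (R : realType) (d k r : nat)
    (hd : (2 <= d)%N) (hk : (k <= d)%N) (hr : (1 <= r)%N)
    (V : 'I_d.+1 -> 'rV[R]_d) (hV : affinely_independent V)
    (t : forall s : nat, {set 'I_d.+1} -> s.-tuple 'rV[R]_d)
    (ht : forall (s : nat) (e : {set 'I_d.+1}), e \in subsimplices d s ->
            orthonormal_basis (tangent V e) (t s e)) :
  direct_sum (fun i : dofidx d k => admissible i)
             (fun i : dofidx d k => component V t i r)
             (PolyForm r k)
  /\
  forall om om' : 'rV[R]_d -> 'M[R]_(k, d) -> R,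
    PolyForm r k om -> PolyForm r k om' ->
    (forall i : dofidx d k, admissible i ->
       forall q : 'rV[R]_d -> R, coef_space V i r q ->
         dof V t i q om = dof V t i q om') ->
    om = om'.
Proof.
have sumsE := component_sumsE hV ht k hr.
split; first split.
- by rewrite -sumsE.
- move=> w w' hw hw' e i hi; apply/eqP; rewrite -subr_eq0; apply/eqP.
  apply: (components_eq0 hV ht (w := fun i => w i - w' i)) i hi => [i hi|i hi q hq].
    by apply: componentD; [exact: hw | apply: componentN; exact: hw'].
  have S : PolyForm r k (\sum_(i : dofidx d k | admissible i) w i).
    by rewrite -sumsE; exists w.
  (* The sum of the differences is a form minus itself, so [dofB] makes its degrees of freedom
     zero. *)
  by rewrite sumrB -e (dofB _ hi hq S S) subrr.
- move=> om om' h h' e; apply/eqP; rewrite -subr_eq0; apply/eqP.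
  have S : PolyForm r k (om - om') by apply: PolyFormD => //; exact: PolyFormN.
  (* Spanning turns the difference of the two forms into a sum of components with zero degrees of
     freedom. *)
  have := S; rewrite -sumsE => -[w hw wE].
  rewrite wE big1 // => i hi.
  apply: (components_eq0 hV ht hw) i hi => i hi q hq.
  by rewrite -wE (dofB _ hi hq h h') (e _ hi _ hq) subrr.
Qed.
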